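(* Let $f:(0,\infty)\to(0,1]$ be a function that decreases to zero and is regularly varying at infinity with index of regular variation $-\gamma$, where $\gamma\in[0,1)$. Let $\omega(G_t(f))$ and $c^{\rm glob}(G_t(f))$ be the clique number and the global clustering coefficient of the random multigraph $G_t(f)$. Then, for every $\delta\in(0,1)$, there exist positive constants $c_1$ and $c_2$ depending on $\delta$ only such that $$ \mathbb{P}\left(\frac{c_1}{\omega(G_t(f))^{1+\delta}}\le c^{\rm glob}(G_t(f))\le\frac{c_2}{\omega(G_t(f))^{1-\delta}}\right)\ge1-\frac{1}{\log t}. $$
   Context: Multigraphs may have loops and multiple edges; a loop contributes 2 to the degree of its vertex. For a finite connected multigraph $G$, $\pi_G$ is the probability distribution on its vertices $\pi_G(v)=\deg(v)/\sum_{w\in G}\deg(w)$. Process $G_t(f)$, indexed by discrete time $t$: let $(Z_t)_{t\ge1}$ be independent with $Z_t\sim\mathrm{Ber}(f(t))$. $G_0$ is one vertex with one self-loop. Given $G_t$: if $Z_{t+1}=1$ (vertex-step), add a new vertex and connect it by one edge to a vertex of $G_t$ chosen according to $\pi_{G_t}$; if $Z_{t+1}=0$ (edge-step), add a new edge between two vertices of $G_t$ chosen independently, each according to $\pi_{G_t}$ (possibly creating a loop or a multiple edge). The result is $G_{t+1}$. The clique number of a multigraph is the size of the largest set of pairwise adjacent vertices. For a multigraph $G$ let $\widehat G$ be the simple graph obtained by removing loops and reducing multiple edges to single edges; $\Delta(G)$ is the number of triangles of $\widehat G$ and $\Lambda(G)$ the number of cherries (paths of length two) of $\widehat G$. The global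 clustering coefficient is $c^{\rm glob}(G)=3\,\Delta(G)/\Lambda(G)$. A function $f:(0,\infty)\to(0,\infty)$ is regularly varying at infinity with index $\beta\in\mathbb{R}$ if $\lim_{t\to\infty}f(at)/f(t)=a^{\beta}$ for all $a>0$.
   Formalization: The probability bound is asserted for all sufficiently large t (with a threshold that may depend on f, γ and δ); for every t it fails, e.g. if f=1 on (0,3], then G_3 has cherries but no triangle. *)

(* Defs.v *)
From HB Require Import structures.
From mathcomp Require Import all_boot all_order all_algebra.
From mathcomp Require Import all_classical all_reals all_analysis.
Import numFieldNormedType.Exports.
Set Implicit Arguments.
Unset Strict Implicit.
Unset Printing Implicit Defensive.
Import Order.TTheory GRing.Theory Num.Theory.
Local Open Scope ring_scope.

(* A finite multigraph on the vertices 0, ..., nv - 1. Each item of [edges] is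
   one edge; the order of its two endpoints is irrelevant, and an item (v, v)
   is a loop. *)
Record mgraph := MGraph { nv : nat; edges : seq ('I_nv * 'I_nv) }.

Definition tagged_of_mgraph (g : mgraph) : {n : nat & seq ('I_n * 'I_n)} :=
  Tagged (fun n => seq ('I_n * 'I_n)) (edges g).

Definition mgraph_of_tagged (x : {n : nat & seq ('I_n * 'I_n)}) : mgraph :=
  MGraph (tagged x).

Lemma tagged_of_mgraphK : cancel tagged_of_mgraph mgraph_of_tagged.
Proof. by case. Qed.

HB.instance Definition _ :=
  Countable.copy mgraph (can_type tagged_of_mgraphK).

Section Multigraphs.
Variable g : mgraph.
Implicit Types (u v : 'I_(nv g)) (A : {set 'I_(nv g)}).

(* The number of edge ends at v, so that a loop counts twice. *)
Definition deg v : nat := (\sum_(e <- edges g) ((e.1 == v) + (e.2 == v)))%N.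

(* Adjacency of distinct vertices, i.e. the edge relation of the simple graph
   obtained by removing loops and merging multiple edges. *)
Definition adj u v : bool :=
  (u != v) && (((u, v) \in edges g) || ((v, u) \in edges g)).

Definition clique A : bool :=
  [forall u in A, forall v in A, (u != v) ==> adj u v].

Definition clique_number : nat := (\max_(A | clique A) #|A|)%N.

Definition triangles : nat := #|[set A | clique A & #|A| == 3%N]|.

(* A path of length two is given by its middle vertex and the pair of its
   endpoints. *)
Definition cherries : nat :=
  #|[set p : 'I_(nv g) * {set 'I_(nv g)} |
      (#|p.2| == 2%N) && (p.2 \subset [set u | adj p.1 u])]|.

End Multigraphs.

(* With the library convention x / 0 = 0 when there is no cherry. *)
Definition global_clustering (R : realType) (g : mgraph) : R :=
  3%:R * (triangles g)%:R / (cherries g)%:R.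

Definition deg_law (R : realType) (g : mgraph) (v : 'I_(nv g)) : R :=
  (deg v)%:R / (\sum_(w < nv g) deg w)%:R.

Definition one_loop : mgraph := @MGraph 1 [:: (ord0, ord0)].

Definition vertex_step (g : mgraph) (v : 'I_(nv g)) : mgraph :=
  let old := widen_ord (leqnSn (nv g)) in
  @MGraph (nv g).+1
    ((ord_max, old v) :: [seq (old e.1, old e.2) | e <- edges g]).

Definition edge_step (g : mgraph) (u v : 'I_(nv g)) : mgraph :=
  MGraph ((u, v) :: edges g).

Definition step_prob (R : realType) (z : bool) (g h : mgraph) : R :=
  if z then \sum_(v < nv g) deg_law R v * (h == vertex_step v)%:R
  else \sum_(u < nv g) \sum_(v < nv g)
         deg_law R u * deg_law R v * (h == edge_step u v)%:R.

Local Open Scope classical_set_scope.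

(* Mutual independence of the Z_t and the laws Z_t ~ Ber(f(t)), for t >= 1;
   Z_0 plays no role. *)
Definition independent_bernoulli (R : realType) (d : measure_display)
    (T : measurableType d) (P : probability T R) (f : R -> R)
    (Z : nat -> T -> bool) : Prop :=
  [/\ forall t, (0 < t)%N -> measurable [set w | Z t w],
      forall t, (0 < t)%N -> P [set w | Z t w] = (f t%:R)%:E
    & forall (s : seq nat) (z : nat -> bool), uniq s -> 0%N \notin s ->
        P [set w | {in s, forall i, Z i w = z i}] =
        (\prod_(i <- s) P [set w | Z i w = z i])%E].

(* The processes Z_1, ..., Z_n and G_0, ..., G_t agree with z and g. *)
Definition history (T : Type) (Z : nat -> T -> bool) (G : nat -> T -> mgraph)
    (n t : nat) (z : nat -> bool) (g : nat -> mgraph) : set T :=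
  [set w | (forall i, (0 < i <= n)%N -> Z i w = z i) /\
           (forall i, (i <= t)%N -> G i w = g i)].

(* (Z_t) is as above and, given (Z_t), the sequence (G_t) is a Markov chain
   started at G_0 whose step from G_t to G_{t+1} has law
   step_prob Z_{t+1} G_t. Conditioning on Z_1, ..., Z_n for every n > t, and not
   only on Z_1, ..., Z_{t+1}, expresses that the random choice of endpoints
   does not depend on future values of Z. *)
Definition edge_step_process (R : realType) (d : measure_display)
    (T : measurableType d) (P : probability T R) (f : R -> R)
    (Z : nat -> T -> bool) (G : nat -> T -> mgraph) : Prop :=
  [/\ independent_bernoulli P f Z,
      forall t g, measurable [set w | G t w = g],
      forall w, G 0%N w = one_loop
    & forall (n t : nat) (z : nat -> bool) (g : nat -> mgraph) (h : mgraph),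
        (t < n)%N ->
        P (history Z G n t z g `&` [set w | G t.+1 w = h]) =
        (P (history Z G n t z g) * (step_prob R (z t.+1) (g t) h)%:E)%E].

Definition regularly_varying (R : realType) (f : R -> R) (beta : R) : Prop :=
  forall a : R, 0 < a -> f (a * t) / f t @[t --> +oo] --> a `^ beta.

(* Main.v *)
(* Write beta = 1 - gamma. With probability 1 - O(t^-c), up to factors t^eps, the
   simple graph of G_t has at most t^beta edges, the first vertex has at least
   t^beta neighbours, and there is a clique of order t^(beta/2). These facts
   suffice: with A the number of ordered adjacent pairs, Cauchy-Schwarz gives
   Delta^2 <= A^3, while Lambda <= A^2, Lambda >= C(deg of the first vertex, 2),
   omega (omega - 1) <= A and Delta >= C(omega, 3), so that both omega and the
   inverse of the clustering coefficient are t^(beta/2) up to t^O(eps).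

   Edges: for two vertices born at s and r, the product of their degrees divided
   by the squared number of edges is a supermartingale, so they are adjacent at
   time t with probability at most f(s) f(r) min(1, t / (s r)); now sum over s, r.
   Degrees: the mean of 1 / d_s(t) decays almost like s / t, so by Markov's
   inequality d_s(t) is rarely below (t / s)^(1 - eta).
   Neighbours: between t/2 and t the first vertex gains a neighbour with
   probability about f, and one bounds the mean of 2^(- number of neighbours).
   Clique: most vertices born before t^(1/2 - eta) have degree above
   t^(1/2 + eta/4) at time t/2, and then any two of them are joined before t. *)
Require Import Defs.
From HB Require Import structures.
From mathcomp Require Import all_boot all_order all_algebra.
From mathcomp Require Import all_classical all_reals all_analysis.
From mathcomp Require Import zify ring lra.
Import numFieldNormedType.Exports.
Import Order.TTheory GRing.Theory Num.Theory.
Set Implicit Arguments.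
Unset Strict Implicit.
Unset Printing Implicit Defensive.
Local Open Scope ring_scope.

(** * The chain of edge lists *)

(** A failure probability of [1 / log t] is a modest demand: Markov's inequality for well-chosen
    functionals already gives decay like a power of [t], and logarithms and slowly varying factors
    disappear into [t^eps]. The random graph is replaced by a deterministic operator on edge lists.
    Conditional means become finite averages, and a supermartingale becomes an inequality for one
    application of [step]. Measure theory enters only when the chain is compared with the process,
    and there one inequality is enough: the good event is at least as likely as the chain predicts.
    The degree bound is where [f -> 0] is used: almost all steps are then edge-steps, which draw two
    endpoints, so degrees grow almost linearly. Since [f] is known only up to regular variation, no
    quantitative constant may depend on it; whatever depends on [f] is pushed into the threshold for
    [t], the spare factor being a power [t^eps]. *)

Section Chain.
Variables (R : realFieldType) (w : nat -> R).
Implicit Types (es : seq (nat * nat)) (phi psi : seq (nat * nat) -> R).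
Implicit Types (F G : nat -> R).

Definition ends es : seq nat := flatten [seq [:: e.1; e.2] | e <- es].

Definition dg es (s : nat) : nat := count_mem s (ends es).

(** Drawing a vertex with probability proportional to its degree is drawing one of the [2m] edge
    ends uniformly, and a loop contributes both of its ends. *)
Definition avg es F : R := (\sum_(x <- ends es) F x) / (size es).*2%:R.

(* A graph is kept as the list es of its edges, newest first, with each vertex
   named by its birth time: a vertex born now gets the name size es. Thus
   step phi es is the conditional mean of phi after one more step, and w m is
   the probability that the step made from m edges is a vertex-step. *)
Definition step phi es : R :=
  let m := size es in
  w m * avg es (fun x => phi ((m, x) :: es)) +
  (1 - w m) * avg es (fun x => avg es (fun y => phi ((x, y) :: es))).

(** This makes [size es] a fresh name, so that a newborn vertex has degree 0 before its first edge
    is added. *)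
Definition wf es : bool := (0 < size es)%N && all (ltn^~ (size es)) (ends es).

Lemma ends_cons e es : ends (e :: es) = e.1 :: e.2 :: ends es.
Proof. by []. Qed.

Lemma size_ends es : size (ends es) = (size es).*2.
Proof. by elim: es => //= e es ->. Qed.

Lemma dg_cons x y es s :
  dg ((x, y) :: es) s = ((x == s) + (y == s) + dg es s)%N.
Proof. by rewrite /dg ends_cons /= addnA. Qed.

Lemma dg_gt0 es s : (0 < dg es s)%N = (s \in ends es).
Proof. by rewrite /dg -has_count has_pred1. Qed.

Lemma wf_size es : wf es -> (0 < size es)%N.
Proof. by case/andP. Qed.

Lemma wf_lt es s : wf es -> s \in ends es -> (s < size es)%N.
Proof. by case/andP => _ /allP h /h. Qed.

Lemma wf_cons es x y : wf es -> x \in size es :: ends es -> y \in ends es ->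
  wf ((x, y) :: es).
Proof.
move=> hw hx hy; rewrite /wf /=; apply/and3P; split.
- by move: hx; rewrite inE => /orP[/eqP->//|/(wf_lt hw)/ltnW].
- exact: ltnW (wf_lt hw hy).
- by apply/allP => z /(wf_lt hw) /ltnW.
Qed.

Lemma wf_dg0 es s : wf es -> (size es <= s)%N -> dg es s = 0%N.
Proof.
move=> hw hs; apply/eqP; rewrite -leqn0 leqNgt dg_gt0; apply/negP.
by move=> /(wf_lt hw); rewrite ltnNge hs.
Qed.

Lemma avgD es F G : avg es (fun x => F x + G x) = avg es F + avg es G.
Proof. by rewrite /avg big_split mulrDl. Qed.

Lemma avgZ es c F : avg es (fun x => c * F x) = c * avg es F.
Proof. by rewrite /avg -mulr_sumr mulrA. Qed.

Lemma avg_cst es c : (0 < size es)%N -> avg es (fun=> c) = c.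
Proof.
move=> h; rewrite /avg big_const_seq count_predT size_ends iter_addr addr0.
rewrite -(mulr_natr c) mulfK // pnatr_eq0 double_eq0 -lt0n //.
Qed.

Lemma avg_le es F G : {in ends es, forall x, F x <= G x} -> avg es F <= avg es G.
Proof.
move=> h; apply: ler_wpM2r; first by rewrite invr_ge0.
by rewrite big_seq [leRHS]big_seq; apply: ler_sum.
Qed.

Lemma avg_eq es F G : F =1 G -> avg es F = avg es G.
Proof. by move=> h; rewrite /avg (eq_bigr G). Qed.

Lemma avg_ind es s : avg es (fun x => (x == s)%:R) = (dg es s)%:R / (2 * (size es)%:R).
Proof.
rewrite /avg -natr_sum -muln2 natrM [2 * _]mulrC; congr (_%:R / _).
rewrite /dg -sum1_count [in RHS]big_mkcond /=; apply: eq_bigr => x _.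
by case: (x == s).
Qed.

Hypothesis w01 : forall m, (0 < m)%N -> 0 <= w m <= 1.

Lemma step_le phi psi es : (0 < size es)%N ->
  (forall x y, x \in size es :: ends es -> y \in ends es ->
     phi ((x, y) :: es) <= psi ((x, y) :: es)) ->
  step phi es <= step psi es.
Proof.
move=> /w01 /andP[w0 w1] h; apply: lerD; apply: ler_wpM2l => //.
- by apply: avg_le => x hx; apply: h => //; rewrite inE eqxx.
- by rewrite subr_ge0.
- by apply: avg_le => x hx; apply: avg_le => y hy; apply: h => //; rewrite inE hx orbT.
Qed.

Lemma eq_step phi psi : phi =1 psi -> step phi =1 step psi.
Proof.
move=> h es; rewrite /step; congr (_ * _ + _ * _).
- by apply: avg_eq => x; rewrite h.
- by apply: avg_eq => x; apply: avg_eq => y; rewrite h.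
Qed.

Lemma stepD phi psi es : step (fun e => phi e + psi e) es = step phi es + step psi es.
Proof.
rewrite /step !avgD.
under [in X in _ + _ * X]avg_eq => x do rewrite avgD.
rewrite avgD !mulrDr; ring.
Qed.

Lemma stepZ c phi es : step (fun e => c * phi e) es = c * step phi es.
Proof.
rewrite /step !avgZ.
under [in X in _ + _ * X]avg_eq => x do rewrite avgZ.
rewrite avgZ; ring.
Qed.

Lemma step_cst c es : (0 < size es)%N -> step (fun=> c) es = c.
Proof.
by move=> h; rewrite /step !avg_cst // -mulrDl addrCA subrr addr0 mul1r.
Qed.

(** The outermost [step] is the first step made from [es], so this is the conditional mean of [phi]
    after [n] further steps, and [Ex_add] is the Markov property. *)
Definition Ex n phi es : R := iter n step phi es.

Lemma ExS n phi es : Ex n.+1 phi es = step (Ex n phi) es.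
Proof. by []. Qed.

Lemma Ex_add a b phi es : Ex (a + b) phi es = Ex a (Ex b phi) es.
Proof. by rewrite /Ex iterD. Qed.

(* The parameter k of I and Phi counts the steps that remain. *)
Lemma Ex_le (I : nat -> seq (nat * nat) -> Prop) (Phi : nat -> seq (nat * nat) -> R) :
  (forall k es x y, I k.+1 es -> x \in size es :: ends es -> y \in ends es ->
     I k ((x, y) :: es)) ->
  (forall k es, I k es -> wf es) ->
  (forall k es, I k.+1 es -> step (Phi k) es <= Phi k.+1 es) ->
  forall n es, I n es -> Ex n (Phi 0%N) es <= Phi n es.
Proof.
move=> hI hw hP; elim=> [//|n IH] es hes; rewrite ExS.
apply: le_trans (hP _ _ hes); apply: step_le; first by case/andP: (hw _ _ hes).
by move=> x y hx hy; apply/IH/hI.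
Qed.

Lemma Ex_mono phi psi n es : wf es ->
  (forall e, wf e -> size e = (n + size es)%N -> phi e <= psi e) ->
  Ex n phi es <= Ex n psi es.
Proof.
elim: n es => [|n IH] es hw h; first exact: h.
rewrite !ExS; apply: step_le; first exact: wf_size.
move=> x y hx hy; apply: IH; first exact: wf_cons.
by move=> e he; rewrite /= addnS -addSn => se; apply: h.
Qed.

Lemma eq_Ex phi psi n : phi =1 psi -> Ex n phi =1 Ex n psi.
Proof.
by move=> h; elim: n => [//|n IH] es; rewrite !ExS; apply: eq_step.
Qed.

Lemma ExD n phi psi es :
  Ex n (fun e => phi e + psi e) es = Ex n phi es + Ex n psi es.
Proof.
elim: n es => [//|n IH] es; rewrite !ExS -stepD; exact: eq_step.
Qed.

Lemma ExZ n c phi es : Ex n (fun e => c * phi e) es = c * Ex n phi es.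
Proof.
elim: n es => [//|n IH] es; rewrite !ExS -stepZ; exact: eq_step.
Qed.

Lemma Ex_cst n c es : wf es -> Ex n (fun=> c) es = c.
Proof.
move=> hw; apply/eqP; rewrite eq_le; apply/andP; split.
  apply: (@Ex_le (fun _ es => wf es) (fun _ _ => c)) => // [k e x y|k e] he.
    exact: wf_cons.
  by rewrite step_cst // wf_size.
rewrite -lerN2 -mulN1r -[- c]mulN1r -ExZ.
apply: (@Ex_le (fun _ es => wf es) (fun _ _ => -1 * c)) => // [k e x y|k e he].
  exact: wf_cons.
- by rewrite step_cst ?mulN1r // wf_size.
Qed.

Lemma Ex_sum (I : Type) (r : seq I) (Q : pred I) (phi : I -> seq (nat * nat) -> R) n es :
  wf es ->
  Ex n (fun e => \sum_(i <- r | Q i) phi i e) es = \sum_(i <- r | Q i) Ex n (phi i) es.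
Proof.
move=> hw; elim: r => [|i r IH].
  by rewrite big_nil -[RHS](@Ex_cst n 0 es hw); apply: eq_Ex => e; rewrite big_nil.
rewrite big_cons; case: ifP => hi; rewrite -IH -?ExD; apply: eq_Ex => e;
  by rewrite big_cons hi.
Qed.

Lemma Ex_noninc phi n es : wf es ->
  (forall e x y, wf e -> x \in size e :: ends e -> y \in ends e ->
    phi ((x, y) :: e) <= phi e) ->
  Ex n phi es <= phi es.
Proof.
move=> hw h; apply: (@Ex_le (fun _ es => wf es) (fun _ => phi)) => // [k e x y|k e] he.
  exact: wf_cons.
rewrite -[leRHS](step_cst _ (wf_size he)); apply: step_le; first exact: wf_size.
by move=> x y; apply: h.
Qed.

End Chain.

(** * Adjacency probabilities *)

Section Adjacency.
Variables (R : realFieldType) (w : nat -> R).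
Hypothesis w01 : forall m, (0 < m)%N -> 0 <= w m <= 1.
Implicit Types (es : seq (nat * nat)) (phi psi : seq (nat * nat) -> R).
Implicit Types (s : nat).

(** [G_t] has [t + 1] edges, so the step made from [m] edges is step number [m]: a vertex name is
    its birth time, and the initial vertex is named 0. *)
Definition es0 : seq (nat * nat) := [:: (0%N, 0%N)].

Lemma wf_es0 : wf es0. Proof. by []. Qed.

Definition adjl s s' es : bool :=
  (s != s') && (((s, s') \in es) || ((s', s) \in es)).

Lemma adjl_cons s s' x y es : adjl s s' ((x, y) :: es) =
  adjl s s' es || (s != s') && ((x == s) && (y == s') || (x == s') && (y == s)).
Proof.
rewrite /adjl !inE !xpair_eqE ![x == _]eq_sym ![y == _]eq_sym.
case: (s != s') => //=; rewrite [(s' == x) && _]andbC.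
by case: (_ \in _); case: (_ \in _); case: (s == x); case: (s' == y); case: (s == y);
  case: (s' == x).
Qed.

Lemma adjl_sym s s' es : adjl s s' es = adjl s' s es.
Proof. by rewrite /adjl eq_sym orbC. Qed.

Lemma mem_ends es x y : (x, y) \in es -> (x \in ends es) && (y \in ends es).
Proof.
move=> h; apply/andP; split; apply/flattenP; exists [:: x; y];
  rewrite ?inE ?eqxx ?orbT //; apply/mapP; by exists (x, y).
Qed.

Lemma adjl_ends s s' es : adjl s s' es -> (s \in ends es) && (s' \in ends es).
Proof. by case/andP => _ /orP[] /mem_ends // /andP[-> ->]. Qed.

(* Every functional used below is, along one step, a polynomial of this shape
   in the indicators of the chosen endpoints. *)
Lemma step_quad s s' phi es a0 a1 a2 b0 b1 b2 b11 b12 :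
  (0 < size es)%N ->
  {in ends es, forall x, phi ((size es, x) :: es) <=
     a0 + a1 * (x == s)%:R + a2 * (x == s')%:R} ->
  {in ends es &, forall x y, phi ((x, y) :: es) <=
     b0 + b1 * ((x == s)%:R + (y == s)%:R) + b2 * ((x == s')%:R + (y == s')%:R)
     + b11 * ((x == s)%:R * (y == s)%:R)
     + b12 * ((x == s)%:R * (y == s')%:R + (x == s')%:R * (y == s)%:R)} ->
  let p := (dg es s)%:R / (2 * (size es)%:R) in
  let q := (dg es s')%:R / (2 * (size es)%:R) in
  step w phi es <= w (size es) * (a0 + a1 * p + a2 * q) +
    (1 - w (size es)) *
      (b0 + b1 * (p + p) + b2 * (q + q) + b11 * (p * p) + b12 * (p * q + q * p)).
Proof.
move=> h0 hv he /=; set p := (dg es s)%:R / _; set q := (dg es s')%:R / _.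
have /andP[w0 w1] := w01 h0.
rewrite /step; apply: lerD; apply: ler_wpM2l => //; last first.
- rewrite -(avg_cst b0 h0) -/p -/q.
  have -> : avg es (fun=> b0) + b1 * (p + p) + b2 * (q + q) + b11 * (p * p) +
      b12 * (p * q + q * p) = avg es (fun x => b0 + b1 * p + b2 * q +
      (b1 + b11 * p + b12 * q) * (x == s)%:R + (b2 + b12 * p) * (x == s')%:R).
    rewrite !avgD !avgZ !avg_ind !avg_cst // -/p -/q; ring.
  apply: avg_le => x hx.
  have -> : b0 + b1 * p + b2 * q + (b1 + b11 * p + b12 * q) * (x == s)%:R +
     (b2 + b12 * p) * (x == s')%:R =
     avg es (fun y => b0 + b1 * (x == s)%:R + b2 * (x == s')%:R +
       (b1 + b11 * (x == s)%:R + b12 * (x == s')%:R) * (y == s)%:R +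
       (b2 + b12 * (x == s)%:R) * (y == s')%:R).
    rewrite !avgD !avgZ !avg_ind !avg_cst // -/p -/q; ring.
  apply: avg_le => y hy; apply: le_trans (he x y hx hy) _.
  by rewrite le_eqVlt; apply/orP; left; apply/eqP; ring.
- by rewrite subr_ge0.
- have -> : a0 + a1 * p + a2 * q =
      avg es (fun x => a0 + a1 * (x == s)%:R + a2 * (x == s')%:R).
    by rewrite !avgD !avgZ !avg_ind !avg_cst.
  exact: avg_le.
Qed.

(** The first [s - 1] steps lead from one edge to [s] edges; the next step is the only one at which
    the vertex [s] can be born. *)
Lemma Ex_split s n phi psi : (0 < s <= n)%N ->
  (forall es, wf es -> size es = s -> step w (Ex w (n - s) phi) es <= psi es) ->
  Ex w n phi es0 <= Ex w s.-1 psi es0.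
Proof.
move=> /andP[s0 sn] h.
have -> : n = (s.-1 + (n - s).+1)%N by lia.
rewrite Ex_add; apply: Ex_mono => // es hw hs; rewrite ExS; apply: h => //.
by rewrite hs addn1 prednK.
Qed.

Definition wz s : R := if s == 0%N then 1 else w s.

Lemma wz_ge0 s : 0 <= wz s.
Proof. by rewrite /wz; case: s => //= s; case/andP: (w01 (ltn0Sn s)). Qed.

(** Once the birth time of [s] is past, [d / m] is a supermartingale: an edge-step adds [d / m] to
    the mean degree and keeps the ratio, a vertex-step adds only half of that. The factor 2 is for
    vertex 0, whose loop gives it degree 2 at the start. *)
Lemma deg_mean s n : (s <= n)%N ->
  Ex w n (fun es => (dg es s)%:R / (size es)%:R) es0 <= 2 * wz s / s.+1%:R.
Proof.
pose phi es : R := (dg es s)%:R / (size es)%:R.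
have sup k es : wf es -> (s < size es)%N -> Ex w k phi es <= phi es.
  move=> hw hs.
  apply: (Ex_le w01 (I := fun _ e => wf e /\ (s < size e)%N) (Phi := fun=> phi)) => //.
  - move=> _ e x y [he hse] hx hy; split; first exact: wf_cons.
    exact: ltnW.
  - by move=> _ e [].
  move=> _ e [he hse]; set m := size e; set d := dg e s.
  have m0 : 0 < m%:R :> R by rewrite ltr0n; apply: wf_size.
  have /andP[w0 w1] := w01 (wf_size he).
  apply: (le_trans (@step_quad s s phi e (d%:R / m.+1%:R) (m.+1%:R^-1) 0
     (d%:R / m.+1%:R) (m.+1%:R^-1) 0 0 0 (wf_size he) _ _)).
  - move=> x hx; rewrite /phi /= dg_cons -/m -/d.
    by rewrite (gtn_eqF hse) add0n natrD mul0r addr0 mulrDl addrC [_^-1 * _]mulrC.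
  - move=> x y hx hy; rewrite /phi /= dg_cons -/m -/d !natrD.
    by rewrite le_eqVlt; apply/orP; left; apply/eqP; ring.
  - rewrite -/d -/m /phi -/d -/m -natr1.
    have d0 : 0 <= d%:R / m%:R :> R by rewrite divr_ge0.
    have -> : w m * (d%:R / (m%:R + 1) + (m%:R + 1)^-1 * (d%:R / (2 * m%:R)) +
       0 * (d%:R / (2 * m%:R))) + (1 - w m) * (d%:R / (m%:R + 1) +
       (m%:R + 1)^-1 * (d%:R / (2 * m%:R) + d%:R / (2 * m%:R)) +
       0 * (d%:R / (2 * m%:R) + d%:R / (2 * m%:R)) +
       0 * (d%:R / (2 * m%:R) * (d%:R / (2 * m%:R))) +
       0 * (d%:R / (2 * m%:R) * (d%:R / (2 * m%:R)) +
        d%:R / (2 * m%:R) * (d%:R / (2 * m%:R)))) =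
       d%:R / m%:R - w m * (d%:R / m%:R) / (2 * (m%:R + 1)).
      field; lra.
    rewrite gerBl; apply: divr_ge0; first by apply: mulr_ge0.
    lra.
case: s @phi sup => [|s] phi sup hn.
  apply: le_trans (sup _ _ _ _) _ => //.
  by rewrite /phi /dg /= /wz /= mulr1.
pose c : R := w s.+1 / s.+2%:R.
apply: (@le_trans _ _ (Ex w s (fun=> c) es0)).
  apply: (@Ex_split s.+1 n phi) => // es hw hs.
  have h0 : (0 < size es)%N by rewrite hs.
  apply: le_trans (step_le w01 (psi := phi) h0 _) _.
    move=> x y hx hy; apply: sup; first exact: wf_cons.
    by rewrite /= hs.
  apply: le_trans (@step_quad 0%N 0%N phi es s.+2%:R^-1 0 0 0 0 0 0 0 h0 _ _) _.
  - move=> x /(wf_lt hw); rewrite hs => xs.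
    by rewrite /phi /= dg_cons hs eqxx (ltn_eqF xs) wf_dg0 ?hs // !mul0r !addr0 div1r.
  - move=> x y /(wf_lt hw) + /(wf_lt hw); rewrite hs => xs ys.
    by rewrite /phi /= dg_cons hs (ltn_eqF xs) (ltn_eqF ys) wf_dg0 ?hs // !mul0r !addr0.
  - by rewrite hs /c !mul0r !addr0 mulr0 addr0.
rewrite Ex_cst // /c /wz /= ler_pM2r ?invr_gt0 ?ltr0n //.
have /andP[] := w01 (ltn0Sn s); lra.
Qed.

(* The product of two degrees over the square of the number of edges is a
   supermartingale, and half of it bounds the chance to join the two vertices. *)
Lemma adj_split s s' t es : wf es -> (s < size es)%N -> (s' < size es)%N -> s != s' ->
  Ex w t (fun e => (adjl s s' e)%:R) es <=
  (adjl s s' es)%:R + t%:R * ((dg es s)%:R * (dg es s')%:R) / (2 * (size es)%:R ^+ 2).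
Proof.
move=> hw hs hs' ne.
pose Phi k e : R :=
  (adjl s s' e)%:R + k%:R * ((dg e s)%:R * (dg e s')%:R) / (2 * (size e)%:R ^+ 2).
rewrite -/(Phi t es).
have -> : Ex w t (fun e => (adjl s s' e)%:R) es = Ex w t (Phi 0%N) es.
  by apply: eq_Ex => e; rewrite /Phi !mul0r addr0.
apply: (Ex_le w01 (I := fun _ e => [/\ wf e, (s < size e)%N & (s' < size e)%N])) => //.
- move=> _ e x y [he h1 h2] hx hy; split; [exact: wf_cons|exact: ltnW|exact: ltnW].
- by move=> _ e [].
move=> k e [he h1 h2]; set m := size e; set d := dg e s; set d' := dg e s'.
have m0 : 0 < m%:R :> R by rewrite ltr0n; apply: wf_size.
have /andP[w0 w1] := w01 (wf_size he).
pose a : R := (adjl s s' e)%:R; pose c : R := k%:R / (2 * m.+1%:R ^+ 2).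
apply: (le_trans (@step_quad s s' (Phi k) e (a + c * (d%:R * d'%:R)) (c * d'%:R) (c * d%:R)
   (a + c * (d%:R * d'%:R)) (c * d'%:R) (c * d%:R) 0 (c + 1) (wf_size he) _ _)).
- move=> x hx; rewrite /Phi /= adjl_cons !dg_cons -/m -/d -/d' -/a.
  rewrite (gtn_eqF h1) (gtn_eqF h2) andbF orbF -/a !add0n.
  have [->|_] := eqVneq x s; rewrite ?(negPf ne) /c !natrD /=;
    rewrite le_eqVlt; apply/orP; left; apply/eqP; ring.
- move=> x y hx hy; rewrite /Phi /= adjl_cons !dg_cons -/m -/d -/d' ne /=.
  have ha : (adjl s s' e || (x == s) && (y == s') || (x == s') && (y == s))%:R <=
     a + (x == s)%:R * (y == s')%:R + (x == s')%:R * (y == s)%:R :> R.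
    rewrite /a; case: adjl => /=; do 4!case: (_ == _) => /=; lra.
  rewrite orbA; apply: le_trans (lerD ha (lexx _)) _; rewrite !natrD.
  (* A single endpoint cannot be both [s] and [s'], so the product of the new degrees contains only
     cross terms between the two endpoints. *)
  have : (x == s)%:R * (x == s')%:R = 0 :> R.
    by have [->|] := eqVneq x s; rewrite ?(negPf ne) ?mulr0 ?mul0r.
  have : (y == s)%:R * (y == s')%:R = 0 :> R.
    by have [->|] := eqVneq y s; rewrite ?(negPf ne) ?mulr0 ?mul0r.
  rewrite /c mulrAC.
  move: (k%:R / _) (x == s)%:R (x == s')%:R (y == s)%:R (y == s')%:R.
  move=> K X X' Y Y' hY hX.
  rewrite le_eqVlt; apply/orP; left; apply/eqP.
  rewrite (_ : (X + Y + d%:R) * (X' + Y' + d'%:R) = X * X' + Y * Y' + X * Y' + X' * Y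
     + d'%:R * (X + Y) + d%:R * (X' + Y') + d%:R * d'%:R); last ring.
  rewrite hX hY; ring.
rewrite -/d -/d' -/m /Phi -/a -/d -/d' -/m /c -natr1 -[k.+1%:R]natr1.
set D : R := d%:R; set D' : R := d'%:R; set K : R := k%:R; set M : R := m%:R.
have D0 : 0 <= D by []. have D'0 : 0 <= D' by []. have K0 : 0 <= K by [].
have DD0 : 0 <= D * D' by rewrite mulr_ge0.
have M0 : 0 < M by [].
rewrite -subr_ge0 -/a.
rewrite [X in 0 <= X](_ : _ = w m * ((K / (2 * (M + 1) ^+ 2)) * (D * D' / M) +
  (K / (2 * (M + 1) ^+ 2) + 1) * (D * D') / (2 * M ^+ 2)) +
  K / (2 * (M + 1) ^+ 2) * (D * D') / (2 * M ^+ 2)); last first.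
  by field; lra.
have K1 : 0 <= K / (2 * (M + 1) ^+ 2) by rewrite divr_ge0 // mulr_ge0 // exprn_ge0; lra.
by rewrite !(addr_ge0, mulr_ge0, divr_ge0, exprn_ge0, invr_ge0) //; lra.
Qed.

(** At its birth the younger vertex [s] has degree 1. The chance that its first edge hits [s'], and
    by [adj_split] the chance of a later edge, are both multiples of [d_{s'} / m], whose mean is
    bounded by [deg_mean]. Each of the two births contributes one factor [wz]. *)
Lemma adj_mean s s' t : (s' < s <= t)%N ->
  Ex w t (fun es => (adjl s s' es)%:R) es0 <=
    wz s * wz s' * (t.+1%:R / (s.+1%:R * s'.+1%:R)).
Proof.
case/andP => ss' st.
have s0 : (0 < s)%N by case: s ss' {st}.
have ne : s != s' by rewrite neq_ltn ss' orbT.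
pose n := (t - s)%N.
pose C : R := w s * (t.+1%:R / s.+1%:R) / 2.
have /andP[w0 w1] := w01 s0.
have C0 : 0 <= C by rewrite !(mulr_ge0, divr_ge0).
apply: (@le_trans _ _ (Ex w s.-1 (fun es => C * ((dg es s')%:R / (size es)%:R)) es0)).
  apply: Ex_split; first by rewrite s0.
  move=> es hw hs; rewrite -/n.
  have h0 := wf_size hw.
  pose phi e : R := (adjl s s' e)%:R +
     n%:R * ((dg e s)%:R * (dg e s')%:R) / (2 * (size e)%:R ^+ 2).
  apply: le_trans (step_le w01 (psi := phi) h0 _) _.
    move=> x y hx hy; apply: adj_split => //; first exact: wf_cons.
      by rewrite /= hs.
    by rewrite /= hs ltnW.
  pose c : R := n%:R / (2 * s.+1%:R ^+ 2).
  have na : s \notin ends es.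
    by apply/negP => /(wf_lt hw); rewrite hs ltnn.
  have aF : adjl s s' es = false.
    by apply/negP => /adjl_ends; rewrite (negPf na).
  have dF : dg es s = 0%N by rewrite wf_dg0 // hs.
  (* In the coefficient [1 + c], the 1 is the birth edge joining [s] to [s'] at once, and [c] comes
     from the resulting increase of the degree of [s']. *)
  apply: le_trans (@step_quad s s' phi es (c * (dg es s')%:R) 0 (1 + c) 0 0 0 0 0 h0 _ _) _.
  - move=> x /(wf_lt hw); rewrite hs => xs.
    rewrite /phi /= adjl_cons !dg_cons aF hs eqxx (ltn_eqF xs) (gtn_eqF ss') dF /= !addn0.
    rewrite orbF /c natrD add0n le_eqVlt; apply/orP; left; apply/eqP; ring.
  - move=> x y /(wf_lt hw) + /(wf_lt hw); rewrite hs => xs ys.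
    rewrite /phi /= adjl_cons !dg_cons aF hs (ltn_eqF xs) (ltn_eqF ys) dF /= !andbF.
    by rewrite !(mul0r, mulr0, addr0).
  - rewrite hs !(mul0r, mulr0, addr0) /C /c.
    have -> : t.+1%:R = n%:R + s.+1%:R :> R by rewrite -natrD /n; congr _%:R; lia.
    rewrite -[s.+1%:R]natr1.
    set D' : R := (dg es s')%:R; set N : R := n%:R; set S : R := s%:R.
    have D0 : 0 <= D' by []. have N0 : 0 <= N by [].
    have S0 : 0 < S by rewrite ltr0n.
    rewrite -subr_ge0.
    rewrite [X in 0 <= X](_ : _ = w s * N * D' / (4 * S * (S + 1) ^+ 2)); last first.
      by field; lra.
    by rewrite !(mulr_ge0, invr_ge0, exprn_ge0) //; lra.
rewrite ExZ; have hm : (s' <= s.-1)%N by lia.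
apply: le_trans (ler_wpM2l C0 (deg_mean hm)) _.
rewrite /C /wz; have -> : (s == 0%N) = false by case: s s0 {st ss' ne n C w0 w1 C0 hm}.
rewrite le_eqVlt; apply/orP; left; apply/eqP.
have a1 : s.+1%:R != 0 :> R by rewrite pnatr_eq0.
have a2 : s'.+1%:R != 0 :> R by rewrite pnatr_eq0.
move: a1 a2; move: (s.+1%:R) (s'.+1%:R) => x y hx hy.
by field; rewrite hx hy.
Qed.

(** Endpoints are existing ends or the fresh name, so a vertex absent after its birth time never
    appears. Being present or not yet due can therefore only be lost. *)
Lemma born_noninc s e x y : wf e -> x \in size e :: ends e -> y \in ends e ->
  ((0 < dg ((x, y) :: e) s) || (size ((x, y) :: e) <= s) ->
   (0 < dg e s) || (size e <= s))%N.
Proof.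
move=> he hx hy; rewrite dg_cons /=.
case: (leqP (size e) s) => h; first by rewrite orbT.
have -> : (size e < s)%N = false by rewrite ltnNge ltnW.
rewrite !orbF.
have hxs : (x == s) -> (0 < dg e s)%N.
  move=> /eqP ex; move: hx; rewrite inE ex => /orP[/eqP ee|]; last by rewrite dg_gt0.
  by rewrite ee ltnn in h.
have hys : (y == s) -> (0 < dg e s)%N by move=> /eqP <-; rewrite dg_gt0.
case: posnP hxs hys => // ->.
by case: (x == s) => [/(_ isT)//|_]; case: (y == s) => [/(_ isT)|].
Qed.

Lemma Ex_born s n es : wf es ->
  Ex w n (fun es => (0 < dg es s)%N%:R) es <= ((0 < dg es s) || (size es <= s))%N%:R.
Proof.
move=> hw; pose phi e : R := ((0 < dg e s) || (size e <= s))%N%:R.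
apply: (@le_trans _ _ (Ex w n phi es)).
  by apply: Ex_mono => // e _ _; rewrite /phi ler_nat; case: (0 < _)%N.
apply: Ex_noninc => // e x y he hx hy; rewrite /phi ler_nat.
have := born_noninc (s := s) he hx hy.
by case: (_ || _)%N => // /(_ isT) ->.
Qed.

Lemma born_step s n es : wf es -> size es = s ->
  step w (Ex w n (fun es => (0 < dg es s)%N%:R)) es <= w s.
Proof.
move=> hw hs; have h0 := wf_size hw.
pose phi e : R := ((0 < dg e s) || (size e <= s))%N%:R.
apply: le_trans (step_le w01 (psi := phi) h0 _) _.
  move=> x y hx hy; have hw1 := wf_cons hw hx hy; exact: Ex_born.
apply: le_trans (@step_quad 0%N 0%N phi es 1 0 0 0 0 0 0 0 h0 _ _) _.
- by move=> x _; rewrite !mul0r !addr0 /phi lern1 leq_b1.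
- move=> x y /(wf_lt hw) + /(wf_lt hw); rewrite hs => xs ys.
  by rewrite /phi dg_cons /= hs (ltn_eqF xs) (ltn_eqF ys) wf_dg0 ?hs // ltnn !mul0r !addr0.
- by rewrite hs !(mul0r, mulr0, addr0) mulr1.
Qed.

Lemma born_mean s n : (s <= n)%N ->
  Ex w n (fun es => (0 < dg es s)%N%:R) es0 <= wz s.
Proof.
move=> sn; case: (posnP s) => s0.
  rewrite /wz s0 eqxx -[leRHS](Ex_cst w01 n 1 wf_es0).
  by apply: Ex_mono => // e _ _; rewrite lern1; case: (0 < _)%N.
apply: (@le_trans _ _ (Ex w s.-1 (fun=> w s) es0)); last first.
  by rewrite Ex_cst // /wz (gtn_eqF s0).
apply: Ex_split; first by rewrite s0.
by move=> es hw hs; apply: born_step.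
Qed.

(** Adjacency forces both births, and the step at [s] creates its vertex with probability [w s]
    whatever the past. This supplies the alternative 1 in [min(1, t / (s r))], where [adj_mean] is
    too weak. *)
Lemma adj_born s s' t : (s' < s <= t)%N ->
  Ex w t (fun es => (adjl s s' es)%:R) es0 <= wz s * wz s'.
Proof.
case/andP => ss' st.
have s0 : (0 < s)%N by case: s ss' {st}.
have /andP[w0 w1] := w01 s0.
have hle e u : u = s \/ u = s' -> (adjl s s' e)%:R <= (0 < dg e u)%N%:R :> R.
  move=> hu; rewrite ler_nat; case h : (adjl s s' e) => //.
  by have /andP[h1 h2] := adjl_ends h; rewrite lt0b dg_gt0; case: hu => ->.
apply: (@le_trans _ _ (Ex w s.-1 (fun es => w s * (0 < dg es s')%N%:R) es0)); last first.
  rewrite ExZ /wz (gtn_eqF s0); apply: ler_wpM2l => //; apply: born_mean; lia.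
apply: Ex_split; first by rewrite s0.
move=> es hw hs; have h0 := wf_size hw; case: posnP => hd /=; last first.
  rewrite mulr1; apply: le_trans (born_step (t - s) hw hs).
  apply: step_le => // x y hx hy; apply: Ex_mono => //; first exact: wf_cons.
  by move=> e _ _; apply: hle; left.
(* If [s'] is missing when [s] becomes due, it is missing forever, and the pair is never
   adjacent. *)
rewrite mulr0 -(step_cst w 0 h0); apply: step_le => // x y hx hy.
have hw1 := wf_cons hw hx hy.
apply: (@le_trans _ _ (Ex w (t - s) (fun es => (0 < dg es s')%N%:R) ((x, y) :: es))).
  by apply: Ex_mono => // e _ _; apply: hle; right.
apply: le_trans (Ex_born _ _ hw1) _.
have := born_noninc (s := s') hw hx hy.
rewrite hd /= hs (leqNgt s) ss' /=.
by case: (_ || _)%N => // /(_ isT).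
Qed.

End Adjacency.

(** * Lower tail of the degrees *)

Section DegreeTail.
Variables (R : realType) (w : nat -> R).
Hypothesis w01 : forall m, (0 < m)%N -> 0 <= w m <= 1.
Implicit Types (es : seq (nat * nat)) (s n m : nat) (k : R).

(* 1 / d would lose only a factor 1 - 1 / (2 m) per step when d = 1; with the
   offset k - 1 the factor is close to 1 - 1 / m for every d >= 1. *)
Definition dpot k s es : R :=
  if dg es s == 0%N then 0 else ((dg es s)%:R - 1 + k)^-1.

Lemma dpot_ge0 k s es : 0 < k -> 0 <= dpot k s es.
Proof.
move=> k0; rewrite /dpot; case: posnP => // h; rewrite invr_ge0.
have : 1 <= (dg es s)%:R :> R by rewrite ler1n.
lra.
Qed.

(** The drop [D] is never negative, so early steps do no harm; it has the useful size only when
    vertex-steps are rare ([w m <= k]) and the graph is large ([1 <= k m]). *)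
Lemma dpot_step k s es : 0 < k <= 1 -> wf es -> (s < size es)%N ->
  exists2 D, step w (dpot k s) es <= dpot k s es - D &
    0 <= D /\ (w (size es) <= k -> 1 <= k * (size es)%:R ->
      (1 - 2 * k) / (size es)%:R * dpot k s es <= D).
Proof.
move=> /andP[k0 k1] hw hs; set m := size es; set d := dg es s.
have h0 := wf_size hw.
have m1 : 1 <= m%:R :> R by rewrite ler1n.
have /andP[w0 w1] := w01 h0; rewrite -/m in w0 w1.
have [d0|dp] := posnP d.
  have sn : s \notin ends es by rewrite -dg_gt0 -/d d0.
  have g0 : dpot k s es = 0 by rewrite /dpot -/d d0.
  exists 0; last by rewrite g0 mulr0.
  rewrite g0 subr0 -[leRHS](step_cst w 0 h0); apply: step_le => // x y hx hy.
  rewrite /dpot dg_cons -/d d0.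
  have -> : (x == s) = false.
    move: hx; rewrite inE => /orP[/eqP ->|]; first by rewrite gtn_eqF.
    by apply: contraTF => /eqP ->.
  by have -> : (y == s) = false by apply: contraTF hy => /eqP ->.
pose x : R := d%:R - 1 + k.
have d1 : 1 <= d%:R :> R by rewrite ler1n.
have x0 : 0 < x by rewrite /x; lra.
have gE j e : dg e s = (d + j)%N -> dpot k s e = (x + j%:R)^-1.
  by rewrite /dpot => ->; rewrite addn_eq0 (gtn_eqF dp) /= /x natrD; congr _^-1; lra.
pose g0 : R := x^-1; pose g1 : R := (x + 1)^-1; pose g2 : R := (x + 2)^-1.
have g0E : dpot k s es = g0 by rewrite (gE 0%N) ?addn0 // addr0.
pose p : R := d%:R / (2 * m%:R).
(* [r] is the relative second-order loss when both ends of an edge-step land on [s]; it is at most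
   [1 / (2m)]. *)
pose r : R := p / (x + 2).
have p0 : 0 <= p by rewrite divr_ge0 // mulr_ge0.
have r0 : 0 <= r by rewrite divr_ge0 //; lra.
have rm : r * (2 * m%:R) <= 1.
  rewrite /r /p; have -> : d%:R / (2 * m%:R) / (x + 2) * (2 * m%:R) = d%:R / (x + 2).
    by field; lra.
  by rewrite ler_pdivrMr /x; lra.
have r12 : r <= 1 / 2 by nra.
exists (p / (x * (x + 1)) * (w m + 2 * (1 - w m) * (1 - r))).
  apply: le_trans (step_quad w01 (s := s) (s' := s) (a0 := g0) (a1 := g1 - g0) (a2 := 0)
    (b0 := g0) (b1 := g1 - g0) (b2 := 0) (b11 := g2 - 2 * g1 + g0) (b12 := 0) h0 _ _) _.
  - move=> y hy; rewrite (gE (y == s)); last first.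
      by rewrite dg_cons (gtn_eqF hs) addnC.
    rewrite /g0 /g1; case: (y == s) => /=; rewrite ?addr0;
      rewrite le_eqVlt; apply/orP; left; apply/eqP; ring.
  - move=> y z hy hz; rewrite (gE ((y == s) + (z == s))%N); last first.
      by rewrite dg_cons addnC.
    rewrite !mul0r !addr0 /g0 /g1 /g2.
    case: (y == s); case: (z == s) => /=; rewrite ?addn0 ?add0n ?addn1 ?addr0;
      rewrite le_eqVlt; apply/orP; left; apply/eqP; ring.
  - rewrite -/d -/m -/p g0E le_eqVlt; apply/orP; left; apply/eqP.
    rewrite /g0 /g1 /g2 /r; field; lra.
split.
  apply: mulr_ge0; first by rewrite divr_ge0 // mulr_ge0 //; lra.
  by apply: addr_ge0 => //; rewrite !mulr_ge0 //; lra.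
move=> wk km; rewrite g0E.
have rk : r <= k / 2 by nra.
have e1 : 2 * (1 - k) <= w m + 2 * (1 - w m) * (1 - r) by nra.
have -> : p / (x * (x + 1)) = g0 / m%:R * (d%:R / (2 * (d%:R + k))).
  by rewrite /p /g0 /x; field; rewrite -/x; lra.
have -> : (1 - 2 * k) / m%:R * g0 = g0 / m%:R * (1 - 2 * k) by ring.
rewrite -[leRHS]mulrA; apply: ler_wpM2l.
  by rewrite divr_ge0 // /g0 invr_ge0 ltW.
have [hk|hk] := leP (1 - 2 * k) 0.
  apply: (le_trans hk); rewrite mulr_ge0 //; last by nra.
  by rewrite divr_ge0 // mulr_ge0 //; lra.
(* The offset pays here: [x + 1 = d + k], so [d / (d + k) >= 1 / (1 + k)] for every [d >= 1]. The
   relative drop, in units of [1 / m], is at least [(1 - k) / (1 + k) >= 1 - 2k]. *)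
have e2 : 1 / (2 * (1 + k)) <= d%:R / (2 * (d%:R + k)).
  rewrite ler_pdivrMr; last lra.
  by rewrite mulrAC ler_pdivlMr; nra.
have e3 : 1 - 2 * k <= 1 / (2 * (1 + k)) * (2 * (1 - k)).
  rewrite mulrAC ler_pdivlMr; nra.
apply: (le_trans e3); apply: ler_pM => //; last lra.
by rewrite divr_ge0 // mulr_ge0 //; lra.
Qed.

(** Replaces the one-step factor [1 - a / m] by a quotient of consecutive powers, so that the
    product over the steps telescopes. *)
Lemma powR_ratio_le (a : R) m : 0 <= a -> (0 < m)%N ->
  1 - a / m%:R <= (m%:R / m.+1%:R) `^ a.
Proof.
move=> a0 m0.
have m0' : 0 < m%:R :> R by rewrite ltr0n.
have q0 : 0 < m%:R / m.+1%:R :> R by rewrite divr_gt0.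
rewrite /powR (gt_eqF q0); apply: le_trans (expR_ge1Dx _).
rewrite lerD2l -mulNr mulNr -mulrN; apply: ler_wpM2l => //.
rewrite -[X in ln X]invrK lnV ?posrE ?invr_gt0 // lerN2 invf_div.
have -> : m.+1%:R / m%:R = 1 + m%:R^-1 :> R by rewrite -natr1; field; lra.
apply: le_ln1Dx; have : 0 < m%:R^-1 :> R by rewrite invr_gt0.
lra.
Qed.

End DegreeTail.

Section Tail.
Variables (R : realType) (w : nat -> R).
Hypothesis w01 : forall m, (0 < m)%N -> 0 <= w m <= 1.
Implicit Types (es : seq (nat * nat)) (s n m : nat).
Variables (k : R) (m0 : nat).
Hypothesis k01 : 0 < k <= 2^-1.
Hypothesis m0P : forall m, (m0 <= m)%N -> w m <= k /\ 1 <= k * m%:R.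

Let a : R := 1 - 2 * k.

(** Before [m0] the potential is only known not to increase in mean, hence the factor stays frozen
    at its value for [m0]; this is the [maxn]. *)
Lemma dpot_Ex n s es : wf es -> (s < size es)%N ->
  Ex w n (dpot k s) es <=
    ((maxn (size es) m0)%:R / (size es + n)%:R) `^ a * dpot k s es.
Proof.
have /andP[k0 k1] := k01.
have a0 : 0 <= a by rewrite /a; lra.
move=> hw hs.
pose c m j : R := ((maxn m m0)%:R / (m + j)%:R) `^ a.
pose Phi j e := c (size e) j * dpot k s e.
apply: (@le_trans _ _ (Ex w n (Phi 0%N) es)).
  apply: Ex_mono => // e he _; rewrite /Phi -[leLHS]mul1r.
  apply: ler_wpM2r; first exact: dpot_ge0.
  apply: (@le_trans _ _ (1 `^ a)); first by rewrite powR1.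
  rewrite /c ge0_ler_powR ?nnegrE // ?divr_ge0 //.
  have he0 := wf_size he.
  by rewrite addn0 ler_pdivlMr ?ltr0n // mul1r ler_nat leq_maxl.
apply: (@Ex_le _ _ w01 (fun _ e => wf e /\ (s < size e)%N)) => //.
- move=> _ e x y [he h1] hx hy; split; [exact: wf_cons|exact: ltnW].
- by move=> _ e [].
move=> j e [he h1]; set m := size e.
have hm := wf_size he.
have m_gt0 : 0 < m%:R :> R by rewrite ltr0n.
apply: (@le_trans _ _ (c m.+1 j * step w (dpot k s) e)).
  by rewrite -stepZ; apply: step_le.
have k01' : 0 < k <= 1 by rewrite k0; lra.
have [D hD [D0 hD']] := dpot_step w01 k01' he h1.
rewrite /Phi -/m.
have [hlt|hge] := ltnP m m0.
  have -> : c m j.+1 = c m.+1 j.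
    by rewrite /c addSn addnS (maxn_idPr (ltnW hlt)) (maxn_idPr hlt).
  apply: ler_wpM2l; first exact: powR_ge0.
  by apply: le_trans hD _; rewrite gerBl.
have [wk km] := m0P hge.
have hst : step w (dpot k s) e <= (m%:R / m.+1%:R) `^ a * dpot k s e.
  apply: le_trans hD _; have := hD' wk km; rewrite -/m -/a => h.
  apply: (@le_trans _ _ ((1 - a / m%:R) * dpot k s e)).
    by rewrite mulrBl mul1r lerB.
  apply: ler_wpM2r; first exact: dpot_ge0.
  exact: powR_ratio_le.
apply: (@le_trans _ _ (c m.+1 j * ((m%:R / m.+1%:R) `^ a * dpot k s e))).
  by apply: ler_wpM2l => //; apply: powR_ge0.
rewrite mulrA /c -powRM ?divr_ge0 // addSn addnS.
rewrite le_eqVlt; apply/orP; left; apply/eqP; congr (_ `^ _ * _).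
rewrite (maxn_idPl _) ?(maxn_idPl hge); last exact: leqW.
have h2 : (m + j).+1%:R != 0 :> R by rewrite pnatr_eq0.
have h3 : m.+1%:R != 0 :> R by rewrite pnatr_eq0.
by move: h2 h3; move: (m + j).+1%:R m.+1%:R => u v hu hv; field; rewrite hu hv.
Qed.

(** [1 / k] is the potential of a newborn vertex, of degree 1. Vertex 0 starts with degree 2 and the
    smaller value [1 / (1 + k)]. *)
Lemma dpot_mean s n : (s <= n)%N ->
  Ex w n (dpot k s) es0 <= wz w s / k * ((m0 + s).+1%:R / n.+1%:R) `^ a.
Proof.
have /andP[k0 k1] := k01.
have a0 : 0 <= a by rewrite /a; lra.
move=> sn; set q := _ `^ a.
have qle j : (j <= (m0 + s).+1)%N -> (j%:R / n.+1%:R) `^ a <= q.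
  move=> hj; rewrite /q ge0_ler_powR ?nnegrE ?divr_ge0 //.
  by rewrite ler_pM2r ?invr_gt0 ?ltr0n // ler_nat.
case: s sn @q qle => [|s] sn q qle.
  apply: le_trans (dpot_Ex n wf_es0 _) _ => //.
  rewrite /= add1n [leRHS]mulrC; apply: ler_pM; rewrite ?powR_ge0 ?dpot_ge0 //.
    by apply: qle; lia.
  by rewrite /dpot /dg /= /wz eqxx div1r lef_pV2 ?posrE; lra.
pose c : R := w s.+1 * (k^-1 * q).
apply: (@le_trans _ _ (Ex w s (fun=> c) es0)); last first.
  by rewrite Ex_cst // /c /wz mulrA.
have q0 : 0 <= q by exact: powR_ge0.
apply: (@Ex_split _ _ w01 s.+1 n) => // es hw hs.
have h0 := wf_size hw.
apply: le_trans (step_le w01 (psi := fun e => q * dpot k s.+1 e) h0 _) _.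
  move=> x y hx hy; have hw1 := wf_cons hw hx hy.
  apply: le_trans (dpot_Ex _ hw1 _) _; first by rewrite /= hs.
  apply: ler_wpM2r; first exact: dpot_ge0.
  rewrite /= hs; have -> : (s.+2 + (n - s.+1))%N = n.+1 by lia.
  by apply: qle; lia.
rewrite stepZ.
apply: (@le_trans _ _ (q * (w s.+1 * k^-1))); last by rewrite /c; lra.
apply: ler_wpM2l => //.
apply: le_trans (step_quad w01 (s := 0%N) (s' := 0%N) (a0 := k^-1) (a1 := 0) (a2 := 0)
    (b0 := 0) (b1 := 0) (b2 := 0) (b11 := 0) (b12 := 0) h0 _ _) _.
- move=> x /(wf_lt hw); rewrite hs => xs; rewrite /dpot dg_cons eqxx (ltn_eqF xs).
  by rewrite wf_dg0 ?hs // !mul0r !addr0 /= subrr add0r.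
- move=> x y /(wf_lt hw) + /(wf_lt hw); rewrite hs => xs ys.
  by rewrite /dpot dg_cons (ltn_eqF xs) (ltn_eqF ys) wf_dg0 ?hs // !mul0r !addr0.
- by rewrite hs !(mul0r, mulr0, addr0).
Qed.

Lemma deg_low (K : R) s n : (s <= n)%N -> 0 < K ->
  Ex w n (fun e => ((0 < dg e s)%N && ((dg e s)%:R < K))%:R) es0 <=
    K * (wz w s / k * ((m0 + s).+1%:R / n.+1%:R) `^ a).
Proof.
have /andP[k0 k1] := k01.
move=> sn K0.
apply: le_trans (ler_wpM2l (ltW K0) (dpot_mean sn)); rewrite -ExZ.
apply: Ex_mono => // e he _; rewrite /dpot; case: posnP => h /=.
  by rewrite mulr0.
have h1 : 1 <= (dg e s)%:R :> R by rewrite ler1n.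
case: ltP => hK /=; last by rewrite mulr_ge0 ?invr_ge0; lra.
by rewrite ler_pdivlMr; lra.
Qed.

End Tail.

(** * Neighbours of the first vertex and cliques *)

Section LowerBounds.
Variables (R : realType) (w : nat -> R).
Hypothesis w01 : forall m, (0 < m)%N -> 0 <= w m <= 1.
Hypothesis wmono : forall m n, (0 < m <= n)%N -> w n <= w m.
Implicit Types (es : seq (nat * nat)) (s n m a b t L S : nat) (K : R).

Lemma dg_cons_ge e x y s : (dg e s <= dg ((x, y) :: e) s)%N.
Proof. by rewrite dg_cons leq_addl. Qed.

Definition sdeg0 es : nat := (\sum_(s < size es) adjl 0%N s es)%N.

Lemma sdeg0_cons es x y : wf es -> (sdeg0 es <= sdeg0 ((x, y) :: es))%N.
Proof.
move=> hw; rewrite /sdeg0 [leqRHS]big_ord_recr /=; apply: leq_trans (leq_addr _ _).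
by apply: leq_sum => i _; rewrite adjl_cons; case: adjl.
Qed.

Lemma sdeg0_vertex es x : wf es ->
  (sdeg0 es + (x == 0%N) <= sdeg0 ((size es, x) :: es))%N.
Proof.
move=> hw; rewrite /sdeg0 [leqRHS]big_ord_recr /=; apply: leq_add.
  by apply: leq_sum => i _; rewrite adjl_cons; case: adjl.
rewrite adjl_cons eqxx (ltn_eqF (wf_size hw)) /=.
by case: (x == 0%N) => //=; rewrite !orbT.
Qed.

(** A newborn attached to vertex 0 is certainly a new neighbour and halves [2^-sdeg0]; other steps
    cannot increase it. Degrees only grow and [w] decreases, so such an attachment has probability
    at least [w t * K / (2t)], and halving gives half of this as the rate. *)
Lemma leaf_Ex K t b es : 0 < K -> wf es -> K <= (dg es 0%N)%:R ->
  (size es + b = t.+1)%N -> 0 <= w t * K / (4 * t%:R) ->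
  Ex w b (fun e => 2^-1 ^+ sdeg0 e) es <=
    expR (- (w t * K / (4 * t%:R))) ^+ b * 2^-1 ^+ sdeg0 es.
Proof.
move=> K0 hw hK hs; set c := w t * K / _ => c0.
pose I j e := [/\ wf e, K <= (dg e 0%N)%:R & (size e + j = t.+1)%N].
pose Phi j e : R := expR (- c) ^+ j * 2^-1 ^+ sdeg0 e.
have -> : Ex w b (fun e => 2^-1 ^+ sdeg0 e) es = Ex w b (Phi 0%N) es.
  by apply: eq_Ex => e; rewrite /Phi mul1r.
apply: (@Ex_le _ _ w01 I) => //.
- move=> j e x y [he h1 h2] hx hy; split; [exact: wf_cons| |by rewrite /= addSnnS].
  by apply: le_trans h1 _; rewrite ler_nat dg_cons_ge.
- by move=> j e [].
move=> j e [he h1 h2]; rewrite /Phi stepZ exprS -mulrA mulrCA.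
apply: ler_wpM2l; first by rewrite exprn_ge0 // expR_ge0.
set g := 2^-1 ^+ sdeg0 e; set m := size e.
have g0 : 0 <= g by rewrite exprn_ge0 // invr_ge0.
have hm := wf_size he; have /andP[w0 w1] := w01 hm.
have gle i j' : (i <= j')%N -> 2^-1 ^+ j' <= 2^-1 ^+ i :> R.
  by move=> h; apply: ler_wiXn2l => //; lra.
apply: le_trans (step_quad w01 (s := 0%N) (s' := 0%N) (a0 := g) (a1 := - (g / 2)) (a2 := 0)
  (b0 := g) (b1 := 0) (b2 := 0) (b11 := 0) (b12 := 0) hm _ _) _.
- move=> x hx; apply: le_trans (gle _ _ (sdeg0_vertex x he)) _.
  by rewrite exprD -/g mul0r addr0; case: (x == 0%N); rewrite /= ?expr1 ?expr0; lra.
- by move=> x y hx hy; rewrite !mul0r !addr0; apply/gle/sdeg0_cons.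
rewrite !mul0r !addr0 -/m.
have m1 : 1 <= m%:R :> R by rewrite ler1n.
have mt : m%:R <= t%:R :> R by rewrite ler_nat -ltnS -h2 addnS ltnS leq_addr.
have wt : w t <= w m.
  by apply: wmono; rewrite hm /= -(ler_nat R).
have w0t : 0 <= w t.
  have t0 : (0 < t)%N by rewrite -(ltr_nat R); lra.
  by case/andP: (w01 t0).
set p := (dg e 0)%:R / _.
have hp : K / (2 * t%:R) <= p.
  apply: ler_pM; [exact: ltW|by rewrite invr_ge0; lra|exact: h1|].
  by rewrite lef_pV2 ?posrE; lra.
have hc : c <= w m * p / 2.
  rewrite /c (_ : _ / _ = w t * (K / (2 * t%:R)) / 2); last by field; lra.
  by rewrite ler_pM2r ?invr_gt0 //; apply: ler_pM => //; rewrite divr_ge0 //; lra.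
apply: (@le_trans _ _ ((1 - c) * g)).
  have -> : w m * (g + - (g / 2) * p) + (1 - w m) * g = (1 - w m * p / 2) * g by field.
  by apply: ler_wpM2r => //; lra.
by apply: ler_wpM2r => //; apply: expR_ge1Dx.
Qed.

(** After [a] steps either the degree is still below [K], or the remaining [b] steps are handled by
    an exponential moment, using that [sdeg0 < L] implies [1 <= 2^L * 2^-sdeg0]. *)
Lemma leaf_bound K a b L : 0 < K ->
  Ex w (a + b) (fun e => (sdeg0 e < L)%N%:R) es0 <=
  Ex w a (fun e => ((0 < dg e 0)%N && ((dg e 0%N)%:R < K))%:R) es0 +
  2 ^+ L * expR (- (w (a + b)%N * K / (4 * (a + b)%:R))) ^+ b.
Proof.
move=> K0; set c := w _ * K / _; set C := 2 ^+ L * _.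
have C0 : 0 <= C by rewrite mulr_ge0 // exprn_ge0 // expR_ge0.
(* The first term of the bound covers positive degrees below [K]; degree 0 is excluded because
   vertex 0 is present from the start. *)
have z0 : Ex w a (fun e => (dg e 0 == 0)%N%:R) es0 <= 0.
  apply: (Ex_noninc w01 (phi := fun e => (dg e 0 == 0)%N%:R) a wf_es0).
  move=> e x y _ _ _; rewrite ler_nat.
  by have := dg_cons_ge e x y 0; case: (dg e 0) => [|d]; case: (dg _ 0).
rewrite Ex_add -[C](Ex_cst w01 a C wf_es0) -[leRHS]add0r.
apply: le_trans (lerD z0 (lexx _)); rewrite -!ExD; apply: Ex_mono => // e he.
rewrite addn1 => se; rewrite -/(Ex _ _ _ _).
have le1 : Ex w b (fun e => (sdeg0 e < L)%N%:R) e <= 1.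
  rewrite -[leRHS](Ex_cst w01 b 1 he); apply: Ex_mono => // e' _ _.
  by rewrite lern1 leq_b1.
have [d0|d0] /= := posnP (dg e 0).
  by apply: le_trans le1 _; lra.
have [hK|hK] /= := ltP (dg e 0)%:R K.
  by apply: le_trans le1 _; lra.
rewrite !add0r.
have c0 : 0 <= c.
  rewrite /c; case: (posnP (a + b)%N) => [->|h]; first by rewrite mulr0 invr0 mulr0.
  by have /andP[h0 _] := w01 h; rewrite divr_ge0 // mulr_ge0 // ltW.
apply: (@le_trans _ _ (Ex w b (fun e => 2 ^+ L * 2^-1 ^+ sdeg0 e) e)).
  apply: Ex_mono => // e' _ _; case: ltnP => h; last first.
    by rewrite mulr_ge0 // exprn_ge0 // invr_ge0.
  have -> : L = (L - sdeg0 e' + sdeg0 e')%N by rewrite subnK // ltnW.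
  rewrite exprD -mulrA -exprMn mulfV // expr1n mulr1.
  by apply: exprn_ege1; lra.
rewrite ExZ; apply: ler_wpM2l; first by rewrite exprn_ge0.
apply: le_trans (leaf_Ex K0 he hK _ c0) _; first by rewrite se addSn.
rewrite -/c ler_piMr ?exprn_ge0 ?expR_ge0 //.
by apply: exprn_ile1; lra.
Qed.

(* Both endpoints keep degree at least K, so each edge-step joins them with
   conditional probability at least 2 (K / 2m)^2. *)
Lemma nonadj_Ex K t b es s s' : 0 < K -> wf es -> s != s' ->
  K <= (dg es s)%:R -> K <= (dg es s')%:R -> (size es + b = t.+1)%N ->
  w (size es) <= 2^-1 ->
  Ex w b (fun e => (~~ adjl s s' e)%:R) es <= expR (- (K / (2 * t%:R)) ^+ 2) ^+ b.
Proof.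
move=> K0 hw ne hK hK' hs hw2; set c := (K / _) ^+ 2.
pose I j e := [/\ wf e, K <= (dg e s)%:R /\ K <= (dg e s')%:R,
  (size e + j = t.+1)%N & (size es <= size e)%N].
pose Phi j e : R := expR (- c) ^+ j * (~~ adjl s s' e)%:R.
apply: (@le_trans _ _ (Phi b es)); last first.
  by rewrite /Phi ler_piMr ?exprn_ge0 ?expR_ge0 // lern1 leq_b1.
have -> : Ex w b (fun e => (~~ adjl s s' e)%:R) es = Ex w b (Phi 0%N) es.
  by apply: eq_Ex => e; rewrite /Phi mul1r.
apply: (@Ex_le _ _ w01 I) => //.
- move=> j e x y [he [h1 h1'] h2 h3] hx hy.
  split; [exact: wf_cons| |by rewrite /= addSnnS|exact: leqW].
  by split; [apply: le_trans h1 _|apply: le_trans h1' _]; rewrite ler_nat dg_cons_ge.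
- by move=> j e [].
move=> j e [he [h1 h1'] h2 h3]; rewrite /Phi stepZ exprS -mulrA mulrCA.
apply: ler_wpM2l; first by rewrite exprn_ge0 // expR_ge0.
set g := (~~ _)%:R; set m := size e.
have g0 : 0 <= g by rewrite /g.
have hm := wf_size he; have /andP[w0 w1] := w01 hm.
have inends u : K <= (dg e u)%:R -> (u < m)%N.
  by move=> hu; apply: wf_lt => //; rewrite -dg_gt0 -(ltr_nat R); lra.
have gcons x y : (~~ adjl s s' ((x, y) :: e))%:R =
    g * (1 - ((x == s)%:R * (y == s')%:R + (x == s')%:R * (y == s)%:R)) :> R.
  rewrite adjl_cons ne negb_or /g; case: adjl => /=; first by rewrite mul0r.
  rewrite mul1r; have [->|h] := eqVneq x s; have [->|h'] := eqVneq y s';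
    rewrite ?eqxx ?(negPf ne) ?[s' == s]eq_sym ?(negPf ne) ?(negPf h) ?(negPf h') /=;
    rewrite ?andbF ?orbF ?mulr0 ?mul0r ?mulr1 ?addr0 ?subrr ?subr0 //.
  by case: (x == s'); case: (y == s); rewrite /= ?mulr0 ?mul0r ?mulr1 ?addr0 ?add0r ?subrr ?subr0.
apply: le_trans (step_quad w01 (s := s) (s' := s') (a0 := g) (a1 := 0) (a2 := 0)
  (b0 := g) (b1 := 0) (b2 := 0) (b11 := 0) (b12 := - g) hm _ _) _.
- move=> x hx; rewrite gcons !mul0r !addr0 (gtn_eqF (inends s h1)) (gtn_eqF (inends s' h1')).
  by rewrite !mul0r addr0 subr0 mulr1.
- by move=> x y hx hy; rewrite gcons !mul0r !addr0 le_eqVlt; apply/orP; left; apply/eqP; ring.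
rewrite !mul0r !addr0 -/m.
have m1 : 1 <= m%:R :> R by rewrite ler1n.
have mt : m%:R <= t%:R :> R by rewrite ler_nat -ltnS -h2 addnS ltnS leq_addr.
have wm : w m <= 2^-1.
  by apply: le_trans hw2; apply: wmono; rewrite (wf_size hw).
have hp u : K <= (dg e u)%:R -> K / (2 * t%:R) <= (dg e u)%:R / (2 * m%:R).
  move=> hu; apply: ler_pM; [exact: ltW|by rewrite invr_ge0; lra|exact: hu|].
  by rewrite lef_pV2 ?posrE; lra.
have := hp _ h1; have := hp _ h1'; set p := (dg e s)%:R / _; set q := (dg e s')%:R / _.
move=> hq1 hp1.
have k0 : 0 <= K / (2 * t%:R) by rewrite divr_ge0 //; lra.
have hc : c <= p * q by rewrite /c expr2; apply: ler_pM.
apply: (@le_trans _ _ ((1 - c) * g)).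
  (* Since [w m <= 1/2], the factor [2 (1 - w m)] is at least 1, and the joining probability is at
     least [p q >= c]. *)
  have -> : w m * g + (1 - w m) * (g + - g * (p * q + q * p)) =
    (1 - (1 - w m) * 2 * (p * q)) * g by ring.
  have pq0 : 0 <= p * q by rewrite mulr_ge0 // ?(le_trans k0).
  have : 0 <= (2^-1 - w m) * (p * q) by rewrite mulr_ge0 //; lra.
  move: (p * q) (w m) hc => r v hc hr; apply: ler_wpM2r => //; nra.
by apply: ler_wpM2r => //; apply: expR_ge1Dx.
Qed.

End LowerBounds.

Section CliqueBound.
Variables (R : realType) (w : nat -> R).
Hypothesis w01 : forall m, (0 < m)%N -> 0 <= w m <= 1.
Hypothesis wmono : forall m n, (0 < m <= n)%N -> w n <= w m.
Implicit Types (es : seq (nat * nat)) (s n m a b t L S : nat) (K : R).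

Definition nborn S es : nat := (\sum_(s <- iota 1 S) (0 < dg es s))%N.

Definition nlow S K es : nat :=
  (\sum_(s <- iota 1 S) ((0 < dg es s) && ((dg es s)%:R < K)%R))%N.

Definition high S K es : seq nat := [seq s <- iota 1 S | K <= (dg es s)%:R].

Lemma nborn_le S K es : (nborn S es <= size (high S K es) + nlow S K es)%N.
Proof.
rewrite size_filter -sum1_count big_mkcond /= -big_split /=; apply: leq_sum => s _.
by case: (0 < dg es s)%N => //=; case: leP.
Qed.

Lemma nborn_cons S es x y : (nborn S es <= nborn S ((x, y) :: es))%N.
Proof.
apply: leq_sum => s _; have := dg_cons_ge es x y s.
by case: (dg es s) => [|d] //; case: (dg _ s).
Qed.

Lemma nborn_vertex S es x : wf es -> (size es <= S)%N ->
  (nborn S es < nborn S ((size es, x) :: es))%N.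
Proof.
move=> hw hS; have h0 := wf_size hw.
have -> : (nborn S es).+1 = (\sum_(s <- iota 1 S) ((0 < dg es s) + (s == size es)))%N.
  rewrite big_split /= -addn1; congr addn.
  have := count_uniq_mem (size es) (iota_uniq 1 S).
  rewrite mem_iota h0 add1n ltnS hS /= -sum1_count big_mkcond /= => h.
  by rewrite -[LHS]h; apply: eq_bigr => s _; case: eqP.
apply: leq_sum => s _; rewrite dg_cons.
have [->|_] := eqVneq s (size es); first by rewrite wf_dg0 // eqxx.
by rewrite addn0; case: (dg es s) => // d; rewrite addnS.
Qed.

(** Births do not depend on the graph: the step at [s] halves [2^-nborn] with probability [w s], and
    [1 - w s / 2 <= exp(- w s / 2)]. *)
Lemma nborn_Ex S : Ex w S (fun e => 2^-1 ^+ nborn S e) es0 <=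
  expR (- (\sum_(1 <= s < S.+1) w s) / 2).
Proof.
pose I j e := wf e /\ (size e + j = S.+1)%N.
pose Phi j e : R := expR (- (\sum_(size e <= s < size e + j) w s) / 2) * 2^-1 ^+ nborn S e.
have -> : Ex w S (fun e => 2^-1 ^+ nborn S e) es0 = Ex w S (Phi 0%N) es0.
  by apply: eq_Ex => e; rewrite /Phi addn0 big_geq // oppr0 mul0r expR0 mul1r.
apply: (@le_trans _ _ (Phi S es0)); last first.
  rewrite /Phi /= add1n ler_piMr ?expR_ge0 //; apply: exprn_ile1; lra.
apply: (@Ex_le _ _ w01 I) => //.
- by move=> j e x y [he h] hx hy; split; [exact: wf_cons|rewrite /= addSnnS].
- by move=> j e [].
move=> j e [he h]; set m := size e; set g : R := 2^-1 ^+ nborn S e.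
have hm := wf_size he; have /andP[w0 w1] := w01 hm.
have g0 : 0 <= g by rewrite exprn_ge0 // invr_ge0.
set C := expR (- (\sum_(m.+1 <= s < m.+1 + j) w s) / 2).
have gle i j' : (i <= j')%N -> 2^-1 ^+ j' <= 2^-1 ^+ i :> R.
  by move=> h'; apply: ler_wiXn2l => //; lra.
apply: (@le_trans _ _ (step w (fun e => C * 2^-1 ^+ nborn S e) e)).
  by apply: step_le.
rewrite stepZ /Phi -/m -/g.
have -> : expR (- (\sum_(m <= s < m + j.+1) w s) / 2) = C * expR (- (w m / 2)).
  rewrite /C -expRD; congr expR; rewrite addnS addSn big_ltn ?ltnS ?leq_addr //; lra.
rewrite -mulrA; apply: ler_wpM2l; first exact: expR_ge0.
apply: (@le_trans _ _ ((1 - w m / 2) * g)); last first.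
  by apply: ler_wpM2r => //; apply: expR_ge1Dx.
have mS : (m <= S)%N by rewrite -/m in h; lia.
apply: le_trans (step_quad w01 (s := 0%N) (s' := 0%N) (a0 := g / 2) (a1 := 0) (a2 := 0)
  (b0 := g) (b1 := 0) (b2 := 0) (b11 := 0) (b12 := 0) hm _ _) _.
- move=> x hx; apply: le_trans (gle _ _ (nborn_vertex x he mS)) _.
  by rewrite exprS -/g !mul0r !addr0; lra.
- by move=> x y hx hy; rewrite !mul0r !addr0; apply/gle/nborn_cons.
- by rewrite !mul0r !addr0 -/m; lra.
Qed.

Definition hascl L es : bool :=
  `[< exists A : seq nat, [/\ uniq A, (L <= size A)%N &
        {in A &, forall s s', s != s' -> adjl s s' es}] >].

(** Union bound over at most [S^2] pairs. The vertices of high degree are fixed at the start; if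
    they do not form a clique at the end, one of these pairs stayed non-adjacent. *)
Lemma clique_of_high K S L b t es : 0 < K -> wf es -> (size es + b = t.+1)%N ->
  w (size es) <= 2^-1 -> (L <= size (high S K es))%N ->
  Ex w b (fun e => (~~ hascl L e)%:R) es <=
    S%:R ^+ 2 * expR (- (K / (2 * t%:R)) ^+ 2) ^+ b.
Proof.
move=> K0 hw hs hw2 hL; set c := expR _ ^+ b.
have c0 : 0 <= c by rewrite exprn_ge0 // expR_ge0.
pose pr s s' := [&& s != s', K <= (dg es s)%:R & K <= (dg es s')%:R].
apply: (@le_trans _ _ (Ex w b (fun e => \sum_(s <- iota 1 S)
    \sum_(s' <- iota 1 S | pr s s') (~~ adjl s s' e)%:R) es)); last first.
  rewrite Ex_sum //.
  apply: (@le_trans _ _ (\sum_(s <- iota 1 S) \sum_(s' <- iota 1 S) c)); last first.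
    rewrite !big_const_seq !count_predT !iter_addr !addr0 !size_iota.
    by rewrite -mulrnA -[leLHS]mulr_natl natrM expr2.
  apply: ler_sum => s _; rewrite Ex_sum // [leRHS](bigID (pr s)) /=.
  rewrite -[leLHS]addr0; apply: lerD; last exact: sumr_ge0.
  by apply: ler_sum => s' /and3P[h1 h2 h3]; apply: nonadj_Ex.
apply: Ex_mono => // e _ _.
have [//|hn] := boolP (hascl L e).
  by rewrite sumr_ge0 // => i _; rewrite sumr_ge0.
have /hasP[s hs1 /hasP[s' hs1' /andP[h1 h2]]] : has (fun s => has (fun s' =>
    (s != s') && ~~ adjl s s' e) (high S K es)) (high S K es).
  apply: contraNT hn => /hasPn h; apply/asboolP; exists (high S K es).
  split=> //; first by rewrite filter_uniq // iota_uniq.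
  move=> s s' hs1 hs1' ne; have /hasPn/(_ s' hs1') := h s hs1.
  by rewrite ne /= negbK.
move: hs1 hs1'; rewrite !mem_filter => /andP[k1 i1] /andP[k2 i2].
rewrite (big_rem s) //= (big_rem s') //= /pr h1 k1 k2 h2 /= -addrA lerDl.
rewrite addr_ge0 //; first exact: sumr_ge0.
by rewrite sumr_ge0 // => i _; rewrite sumr_ge0.
Qed.

Variables (k : R) (m0 : nat).
Hypothesis k01 : 0 < k <= 2^-1.
Hypothesis m0P : forall m, (m0 <= m)%N -> w m <= k /\ 1 <= k * m%:R.

(** One term for each way to fail: fewer than [2L] of the names [1..S] are born, at least [L] of the
    born ones have degree below [K] after [a] steps, or two of the at least [L] remaining ones are
    not joined in the last [b] steps. *)
Lemma clique_bound K a b S L : 0 < K -> (S <= a)%N -> (0 < L)%N -> w a.+1 <= 2^-1 ->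
  Ex w (a + b) (fun e => (~~ hascl L e)%:R) es0 <=
   2 ^+ (2 * L) * expR (- (\sum_(1 <= s < S.+1) w s) / 2) +
   L%:R^-1 * (K / k * ((m0 + S).+1%:R / a.+1%:R) `^ (1 - 2 * k) *
     \sum_(1 <= s < S.+1) w s) +
   S%:R ^+ 2 * expR (- (K / (2 * (a + b)%:R)) ^+ 2) ^+ b.
Proof.
move=> K0 Sa L0 wa; have /andP[k0 k1] := k01.
set T1 := 2 ^+ _ * _; set T2 := L%:R^-1 * _; set T3 := S%:R ^+ 2 * _.
have T30 : 0 <= T3 by rewrite mulr_ge0 ?exprn_ge0 ?expR_ge0.
have h1 : Ex w a (fun e => (nborn S e < 2 * L)%N%:R) es0 <= T1.
  apply: (@le_trans _ _ (Ex w a (fun e => 2 ^+ (2 * L) * 2^-1 ^+ nborn S e) es0)).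
    apply: Ex_mono => // e' _ _; case: ltnP => h; last first.
      by rewrite mulr_ge0 // exprn_ge0 // invr_ge0.
    have -> : (2 * L = 2 * L - nborn S e' + nborn S e')%N by rewrite subnK // ltnW.
    rewrite exprD -mulrA -exprMn mulfV // expr1n mulr1.
    by apply: exprn_ege1; lra.
  rewrite ExZ; apply: ler_wpM2l; first by rewrite exprn_ge0.
  apply: le_trans (nborn_Ex S); rewrite -[X in Ex w X _ _](subnKC Sa) Ex_add.
  apply: Ex_mono => // e he _; apply: Ex_noninc => // e' x y _ _ _.
  by apply: ler_wiXn2l; [lra|lra|exact: nborn_cons].
have h2 : Ex w a (fun e => L%:R^-1 * (nlow S K e)%:R) es0 <= T2.
  rewrite ExZ; apply: ler_wpM2l; first by rewrite invr_ge0.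
  have -> : Ex w a (fun e => (nlow S K e)%:R) es0 =
      \sum_(s <- iota 1 S) Ex w a (fun e => ((0 < dg e s)%N && ((dg e s)%:R < K))%:R) es0.
    by rewrite -Ex_sum //; apply: eq_Ex => e; rewrite natr_sum.
  rewrite mulr_sumr /index_iota subn1 /= big_seq [leRHS]big_seq.
  apply: ler_sum => s; rewrite mem_iota add1n ltnS => /andP[s1 sS].
  apply: le_trans (deg_low w01 k01 m0P (leq_trans sS Sa) K0) _.
  have -> : wz w s = w s by rewrite /wz gtn_eqF.
  have /andP[ws0 _] := w01 s1.
  rewrite [leRHS](_ : _ = K * (w s / k * ((m0 + S).+1%:R / a.+1%:R) `^ (1 - 2 * k))); last by ring.
  rewrite (ler_pM2l K0); apply: ler_wpM2l; first by rewrite divr_ge0 // ltW.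
  apply: ge0_ler_powR; rewrite ?nnegrE ?divr_ge0 //; first lra.
  by rewrite ler_pM2r ?invr_gt0 ?ltr0n // ler_nat ltnS leq_add2l.
rewrite Ex_add -[T3](Ex_cst w01 a T3 wf_es0).
apply: le_trans (lerD (lerD h1 h2) (lexx _)); rewrite -!ExD.
apply: Ex_mono => // e he se; rewrite addn1 in se; rewrite -/(Ex _ _ _ _).
have le1 : Ex w b (fun e => (~~ hascl L e)%:R) e <= 1.
  rewrite -[leRHS](Ex_cst w01 b 1 he); apply: Ex_mono => // e' _ _.
  by rewrite lern1 leq_b1.
have n0 : 0 <= L%:R^-1 * (nlow S K e)%:R :> R by rewrite mulr_ge0 // invr_ge0.
have [hN|hN] /= := ltnP (nborn S e) (2 * L).
  by apply: le_trans le1 _; lra.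
have [hl|hl] := leqP L (nlow S K e).
  apply: le_trans le1 _.
  have : 1 <= L%:R^-1 * (nlow S K e)%:R :> R.
    by rewrite mulrC ler_pdivlMr ?ltr0n // mul1r ler_nat.
  lra.
have hh : (L <= size (high S K e))%N.
  by rewrite -(leq_add2r (nlow S K e)) (leq_trans _ (nborn_le S K e)) // (leq_trans _ hN) //
    mul2n -addnn leq_add2l ltnW.
apply: le_trans (clique_of_high K0 he (t := a + b) _ _ hh) _; rewrite ?se //.
by rewrite -/T3; lra.
Qed.

End CliqueBound.

(** * Mean number of adjacent pairs *)

Section AdjacentPairs.
Variables (R : realType) (w : nat -> R).
Hypothesis w01 : forall m, (0 < m)%N -> 0 <= w m <= 1.
Implicit Types (es : seq (nat * nat)) (s t : nat).

Definition npairs es : nat :=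
  (\sum_(s < size es) \sum_(r < size es) adjl s r es)%N.

(** Interpolation [min(1, x) <= x^(1 - g)] with [x = t / (s r)]. Multiplied by the births, of order
    [(s r)^(-g)], it gives exactly [t^(1 - g) / (s r)], and the double sum becomes the square of a
    harmonic sum. *)
Lemma adj_mean_powR s r t (C g : R) : 0 <= g <= 1 ->
  (forall i, wz w i <= C * i.+1%:R `^ (- g)) -> (s <= t)%N -> (r <= t)%N ->
  Ex w t (fun e => (adjl s r e)%:R) es0 <=
    C ^+ 2 * t.+1%:R `^ (1 - g) * (s.+1%:R^-1 * r.+1%:R^-1).
Proof.
move=> /andP[g0 g1] hC.
wlog rs : s r / (r <= s)%N => [hwlog|] st rt.
  have [|/ltnW] := leqP r s; first by move=> h; apply: hwlog.
  move=> h; have := hwlog r s h rt st; rewrite [r.+1%:R^-1 * _]mulrC.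
  by apply: le_trans; apply: Ex_mono => // e _ _; rewrite adjl_sym.
have C0 : 0 <= C.
  have := hC 0%N; rewrite powR1 mulr1; apply: le_trans; rewrite /wz eqxx; lra.
have rhs0 q : 0 <= C ^+ 2 * t.+1%:R `^ (1 - g) * (s.+1%:R^-1 * q.+1%:R^-1).
  by rewrite !mulr_ge0 ?exprn_ge0 ?powR_ge0.
move: rs; rewrite leq_eqVlt => /orP[/eqP ->|rs].
  apply: (@le_trans _ _ 0) => //.
  rewrite -[leRHS](Ex_cst w01 t 0 wf_es0); apply: Ex_mono => // e _ _.
  by rewrite /adjl eqxx.
have hst : (r < s <= t)%N by rewrite rs.
pose x : R := t.+1%:R / (s.+1%:R * r.+1%:R).
have x0 : 0 < x by rewrite divr_gt0 // mulr_gt0.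
pose u := wz w s * wz w r.
have u0 : 0 <= u by rewrite mulr_ge0 // wz_ge0.
have ux : Ex w t (fun e => (adjl s r e)%:R) es0 <= u * x `^ (1 - g).
  have [x1|x1] := leP x 1.
    apply: le_trans (adj_mean w01 hst) _; rewrite -/u -/x; apply: ler_wpM2l => //.
    by apply: ger1_powR; [rewrite x0|lra].
  apply: le_trans (adj_born w01 hst) _; rewrite -/u -[leLHS]mulr1.
  apply: ler_wpM2l => //; apply: (@le_trans _ _ (1 `^ (1 - g))); first by rewrite powR1.
  by apply: ge0_ler_powR; [lra|rewrite nnegrE|rewrite nnegrE ltW|exact: ltW].
apply: (le_trans ux).
have uC : u <= C ^+ 2 * (s.+1%:R * r.+1%:R) `^ (- g).
  rewrite powRM // expr2 mulrACA; apply: ler_pM => //; exact: wz_ge0.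
apply: le_trans (ler_wpM2r (powR_ge0 _ _) uC) _.
rewrite -![_ ^+ 2 * _ * _]mulrA; apply: ler_wpM2l; first exact: exprn_ge0.
have y0 : 0 < s.+1%:R * r.+1%:R :> R by rewrite mulr_gt0.
rewrite le_eqVlt; apply/orP; left; apply/eqP; rewrite /x -invfM.
move: (s.+1%:R * r.+1%:R) y0 => y y0.
rewrite powRM ?invr_ge0 ?(ltW y0) // mulrCA; congr (_ * _).
rewrite -!powR_inv1 ?(ltW y0) // -powRrM -powRD; last by rewrite (gt_eqF y0) implybT.
by congr (_ `^ _); ring.
Qed.

Lemma npairs_mean t (C g : R) : 0 <= g <= 1 ->
  (forall i, wz w i <= C * i.+1%:R `^ (- g)) ->
  Ex w t (fun e => (npairs e)%:R) es0 <=
    C ^+ 2 * t.+1%:R `^ (1 - g) * (\sum_(s < t.+1) s.+1%:R^-1) ^+ 2.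
Proof.
move=> hg hC.
apply: (@le_trans _ _ (Ex w t (fun e =>
    \sum_(s < t.+1) \sum_(r < t.+1) (adjl s r e)%:R) es0)).
  apply: Ex_mono => // e _; rewrite addn1 => <-.
  by rewrite natr_sum; apply: ler_sum => s _; rewrite natr_sum.
rewrite Ex_sum //; set q := C ^+ 2 * _.
have -> : q * (\sum_(s < t.+1) s.+1%:R^-1) ^+ 2 =
    \sum_(s < t.+1) \sum_(r < t.+1) q * (s.+1%:R^-1 * r.+1%:R^-1).
  rewrite expr2 mulr_suml mulr_sumr; apply: eq_bigr => s _.
  by rewrite !mulr_sumr.
apply: ler_sum => s _; rewrite Ex_sum //; apply: ler_sum => r _.
by apply: adj_mean_powR; rewrite // -ltnS.
Qed.

Lemma harmonic_le t : \sum_(s < t.+1) s.+1%:R^-1 <= 1 + ln t.+1%:R :> R.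
Proof.
elim: t => [|t IH]; first by rewrite big_ord1 ln1 invr1 addr0.
rewrite big_ord_recr /=.
have h : t.+2%:R^-1 <= ln t.+2%:R - ln t.+1%:R :> R.
  rewrite -ln_div ?posrE //.
  have -> : t.+2%:R / t.+1%:R = (1 + - t.+2%:R^-1)^-1 :> R.
    have e1 : t.+2%:R = t.+1%:R + 1 :> R by rewrite natr1.
    have e2 : t.+1%:R > 0 :> R by [].
    rewrite e1; move: e2; move: (t.+1%:R : R) => y y0.
    have -> : 1 + - (y + 1)^-1 = y / (y + 1) by field; lra.
    by rewrite invf_div.
  have i1 : 0 < t.+2%:R^-1 :> R by rewrite invr_gt0.
  have i2 : t.+2%:R^-1 < 1 :> R by rewrite invf_lt1 // ltr1n.
  rewrite lnV; last by rewrite posrE subr_gt0.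
  by rewrite lerNr; apply: le_ln1Dx; rewrite ltrN2.
apply: (le_trans (lerD IH h)); move: (ln _) (ln _) => u v; lra.
Qed.

End AdjacentPairs.

(** * Counting in the simple graph *)

Section GraphCounts.
Variable g : mgraph.
Implicit Types (u v x : 'I_(nv g)) (A B : {set 'I_(nv g)}).

Definition sdeg u : nat := (\sum_v adj u v)%N.

Definition adj_pairs : nat := (\sum_u sdeg u)%N.

Lemma sdegE u : sdeg u = #|[set v | adj u v]|.
Proof.
by rewrite -sum1dep_card [RHS]big_mkcond; apply: eq_bigr => v _; case: adj.
Qed.

Lemma cherriesE : cherries g = (\sum_v 'C(sdeg v, 2))%N.
Proof.
rewrite /cherries -sum1_card.
rewrite (partition_big (fun p : 'I_(nv g) * {set 'I_(nv g)} => p.1) predT) //=.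
apply: eq_bigr => v _; rewrite sdegE -cards_draws sum1dep_card.
rewrite -[RHS](card_imset _ (f := pair v)); last by move=> A B [].
apply: eq_card => -[x A]; rewrite !inE /=; apply/idP/imsetP => /=.
  by case/andP => /andP[h1 h2] /eqP e; exists A; rewrite ?inE ?h1 -e ?h2.
by case=> B; rewrite inE => /andP[h1 h2] [-> ->]; rewrite h1 h2 eqxx.
Qed.

Lemma cherries_ge u : ('C(sdeg u, 2) <= cherries g)%N.
Proof. by rewrite cherriesE (bigD1 u) //= leq_addr. Qed.

Lemma sum_sqr_le (I : finType) (F : I -> nat) :
  (\sum_i F i ^ 2 <= (\sum_i F i) ^ 2)%N.
Proof.
rewrite -[leqRHS]mulnn big_distrl /=.
apply: leq_sum => i _; rewrite -mulnn leq_mul2l.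
by rewrite (bigD1 i) //= leq_addr orbT.
Qed.

Lemma cherries_le : (cherries g <= adj_pairs ^ 2)%N.
Proof.
rewrite cherriesE; apply: leq_trans (sum_sqr_le _); apply: leq_sum => v _.
rewrite bin2 -mulnn; move: (sdeg v) => d; lia.
Qed.

Lemma cliqueP A : reflect {in A &, forall u v, u != v -> adj u v} (clique A).
Proof.
apply: (iffP forall_inP) => [h u v hu hv ne|h u hu].
  by have /forall_inP/(_ v hv)/implyP/(_ ne) := h u hu.
by apply/forall_inP => v hv; apply/implyP; apply: h.
Qed.

Lemma clique_sub A B : B \subset A -> clique A -> clique B.
Proof.
move=> /fintype.subsetP sBA /cliqueP h; apply/cliqueP => u v hu hv.
by apply: h; apply: sBA.
Qed.

Lemma clique_card_le A : clique A -> (#|A| <= clique_number g)%N.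
Proof. by move=> hA; apply: (bigop.leq_bigmax_cond (F := fun A : {set _} => #|A|)). Qed.

Lemma clique_bigmax : exists2 A : {set 'I_(nv g)}, clique A & #|A| = clique_number g.
Proof.
have h0 : clique (finset.set0 : {set 'I_(nv g)}) by apply/cliqueP => u v; rewrite inE.
rewrite /clique_number; elim/big_ind: _ => [|m n [A hA <-] [B hB <-]|A hA].
- by exists finset.set0; rewrite ?cards0.
- by case: (leqP #|A| #|B|) => h; [exists B|exists A]; rewrite // /maxn ltnNge ?h //= ltnW.
- by exists A.
Qed.

Lemma triangles_ge : ('C(clique_number g, 3) <= triangles g)%N.
Proof.
have [A hA <-] := clique_bigmax; rewrite /triangles -cards_draws.
apply: subset_leq_card; apply/fintype.subsetP => B; rewrite !inE => /andP[sB ->].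
by rewrite (clique_sub sB hA).
Qed.

Lemma clique_number_le : (clique_number g * (clique_number g).-1 <= adj_pairs)%N.
Proof.
have [A /cliqueP hA <-] := clique_bigmax.
rewrite /adj_pairs (bigID (mem A)) /= -sum_nat_const; apply: leq_trans (leq_addr _ _).
apply: leq_sum => u hu; rewrite sdegE (cardsD1 u A) hu /=.
apply: subset_leq_card; apply/fintype.subsetP => v; rewrite !inE => /andP[ne hv].
by apply: hA; rewrite // eq_sym.
Qed.

Definition adj_triples : nat :=
  (\sum_(u < nv g) \sum_v \sum_x (adj u v && (adj u x && adj v x)))%N.

(** Listing the corners maps the ordered adjacent triples onto the triangles. The lost factor 6 is
    harmless. *)
Lemma triangles_le_triples : (triangles g <= adj_triples)%N.
Proof.
pose T := [set p : 'I_(nv g) * 'I_(nv g) * 'I_(nv g) |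
  adj p.1.1 p.1.2 && (adj p.1.1 p.2 && adj p.1.2 p.2)].
have -> : adj_triples = #|T|.
  rewrite /adj_triples pair_bigA /= pair_bigA /= -sum1dep_card.
  by rewrite [RHS]big_mkcond; apply: eq_bigr => p _; case: (_ && _).
apply: leq_trans (leq_imset_card (fun p => [set p.1.1; p.1.2; p.2]) T).
apply: subset_leq_card; apply/fintype.subsetP => A; rewrite inE => /andP[/cliqueP hA /eqP A3].
have /card_gt0P[u uA] : (0 < #|A|)%N by rewrite A3.
have /cards2P[v [x [vx AE]]] : #|A :\ u| == 2%N.
  by move: A3; rewrite (cardsD1 u) uA add1n => -[->].
have [uv vA] : u != v /\ v \in A.
  by have : v \in A :\ u by [rewrite AE !inE eqxx]; rewrite !inE eq_sym => /andP[].
have [ux xA] : u != x /\ x \in A.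
  by have : x \in A :\ u by [rewrite AE !inE eqxx orbT]; rewrite !inE eq_sym => /andP[].
apply/imsetP; exists (u, v, x); first by rewrite inE /= !hA.
by rewrite /= -finset.setUA -AE finset.setD1K.
Qed.

Definition codeg u v : nat := (\sum_x (adj u x && adj v x))%N.

Lemma codeg_sqr_le u v : (codeg u v ^ 2 <= sdeg u * sdeg v)%N.
Proof.
rewrite -mulnn.
by apply: leq_mul; apply: leq_sum => x _; case: (adj u x) => //; case: (adj v x).
Qed.

Lemma adj_triplesE : adj_triples = (\sum_(u < nv g) \sum_v adj u v * codeg u v)%N.
Proof.
apply: eq_bigr => u _; apply: eq_bigr => v _; rewrite /codeg big_distrr /=.
by apply: eq_bigr => x _; case: (adj u v); rewrite ?mul1n ?mul0n.
Qed.

(* Cauchy-Schwarz over adjacent pairs, with codeg^2 <= sdeg * sdeg. *)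
Lemma adj_triples_sqr : (adj_triples ^ 2 <= adj_pairs ^ 3)%N.
Proof.
pose P := ('I_(nv g) * 'I_(nv g))%type.
pose a (p : P) : nat := adj p.1 p.2; pose c (p : P) := codeg p.1 p.2.
have tE : adj_triples = (\sum_p a p * c p)%N by rewrite adj_triplesE pair_bigA.
have pE : adj_pairs = (\sum_p a p)%N by rewrite /adj_pairs /sdeg pair_bigA.
have cE : (\sum_p c p ^ 2 <= adj_pairs ^ 2)%N.
  rewrite -mulnn {1}/adj_pairs big_distrl /=.
  rewrite -(pair_bigA _ (fun u v => codeg u v ^ 2)%N) /=; apply: leq_sum => u _.
  by rewrite /adj_pairs big_distrr /=; apply: leq_sum => v _; apply: codeg_sqr_le.
(* Cauchy-Schwarz after doubling and symmetrizing: with [a] in {0, 1}, each term is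
   [2 a c a' c' <= a c'^2 + a' c^2]. *)
have step1 : ((\sum_p a p * c p) ^ 2 <= (\sum_p a p) * (\sum_p c p ^ 2))%N.
  rewrite -(leq_pmul2l (m := 2)) // -[X in (2 * X <= _)%N]mulnn.
  have -> : (2 * ((\sum_p a p) * (\sum_p c p ^ 2)) =
      \sum_p \sum_q (a p * c q ^ 2 + a q * c p ^ 2))%N.
    rewrite mul2n -addnn {1}big_distrl /= mulnC big_distrl /= -big_split /=.
    apply: eq_bigr => p _; rewrite !big_distrr -big_split /=.
    by apply: eq_bigr => q _; rewrite [(a q * _)%N]mulnC.
  have -> : (2 * ((\sum_p a p * c p) * (\sum_p a p * c p)) =
      \sum_p \sum_q 2 * (a p * c p * (a q * c q)))%N.
    rewrite big_distrl big_distrr /=; apply: eq_bigr => p _.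
    by rewrite !big_distrr.
  apply: leq_sum => p _; apply: leq_sum => q _.
  rewrite /a; case: (adj _ _); case: (adj _ _); rewrite /= ?mul0n ?muln0 ?mul1n ?addn0 //.
  by rewrite addnC; apply: nat_Cauchy.
rewrite tE; apply: (leq_trans step1); rewrite -pE expnS leq_mul2l.
by rewrite cE orbT.
Qed.

Lemma triangles_sqr_le : (triangles g ^ 2 <= adj_pairs ^ 3)%N.
Proof.
by apply: leq_trans adj_triples_sqr; rewrite leq_exp2r // triangles_le_triples.
Qed.

End GraphCounts.

(** * Graphs whose vertices are named by birth times *)

Section Labelling.
Implicit Types (g : mgraph) (es : seq (nat * nat)) (s L : nat).

(** Vertices of an [mgraph] are numbered consecutively, while birth times have a gap at every
    edge-step, so the two are linked by an injective renaming. *)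
Definition coded g es (lab : 'I_(nv g) -> nat) : Prop :=
  [/\ injective lab, es = [seq (lab e.1, lab e.2) | e <- edges g]
    & forall v, (lab v < size es)%N].

Lemma coded_adj g es lab u v : @coded g es lab ->
  adj u v = adjl (lab u) (lab v) es.
Proof.
move=> [inj -> _]; rewrite /adj /adjl (inj_eq inj).
have inj2 : injective (fun e : 'I_(nv g) * 'I_(nv g) => (lab e.1, lab e.2)).
  by move=> [a b] [c d] /= [/inj -> /inj ->].
by rewrite -!(mem_map inj2).
Qed.

Lemma coded_ends g es lab s : @coded g es lab -> s \in ends es -> exists v, s = lab v.
Proof.
move=> [_ -> _]; rewrite /ends -map_comp => /flattenP[l /mapP[e _ ->]] /=.
by rewrite !inE => /orP[] /eqP ->; [exists e.1|exists e.2].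
Qed.

Lemma sum_inj_le (I J : finType) (h : I -> J) (F : J -> nat) : injective h ->
  (\sum_i F (h i) <= \sum_j F j)%N.
Proof.
move=> inj; rewrite [leqRHS](bigID (mem (h @: [set: I]))) /=.
apply: leq_trans (leq_addr _ _); rewrite big_imset /=; last by move=> x y _ _ /inj.
by rewrite leq_eqVlt; apply/orP; left; apply/eqP; apply: eq_bigl => i; rewrite inE.
Qed.

Lemma adj_pairs_le g es lab : @coded g es lab -> (adj_pairs g <= npairs es)%N.
Proof.
move=> hc; have [inj _ hlt] := hc.
pose o v := Ordinal (hlt v).
have oinj : injective o by move=> u v /(congr1 val) /inj.
apply: leq_trans (sum_inj_le (fun s : 'I_(size es) =>
  \sum_(r < size es) adjl s r es)%N oinj).
apply: leq_sum => u _.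
apply: leq_trans (sum_inj_le (fun r : 'I_(size es) => adjl (o u) r es : nat) oinj).
by apply: leq_sum => v _; rewrite (coded_adj u v hc).
Qed.

Lemma cherries_ge_sdeg0 g es lab : @coded g es lab ->
  ('C(sdeg0 es, 2) <= cherries g)%N.
Proof.
move=> hc; have [inj _ hlt] := hc.
(* [coded] does not say that 0 is a label. If 0 has a neighbour it is an edge end, hence a label;
   otherwise the binomial vanishes. *)
have [->//|d0] := posnP (sdeg0 es).
have : [exists s : 'I_(size es), adjl 0 s es].
  apply: contraLR d0 => /existsPn h; rewrite -leqNgt leqn0 sum_nat_eq0.
  by apply/forallP => s; rewrite (negPf (h s)).
move=> /existsP[s0 /adjl_ends/andP[/(coded_ends hc)[u0 hu0] _]].
apply: leq_trans (cherries_ge u0); apply: leq_bin2l.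
pose o v := Ordinal (hlt v).
have oinj : injective o by move=> u v /(congr1 val) /inj.
have -> : sdeg u0 = (\sum_(v < nv g) adjl 0 (o v) es)%N.
  by apply: eq_bigr => v _; rewrite (coded_adj u0 v hc) -hu0.
have -> : (\sum_(v < nv g) adjl 0 (o v) es =
    \sum_(s in o @: [set: 'I_(nv g)]) adjl 0 s es)%N.
  rewrite big_imset /=; last by move=> x y _ _ /oinj.
  by apply: eq_bigl => v; rewrite inE.
rewrite /sdeg0 [leqRHS]big_mkcond /=; apply: leq_sum => s _.
case: imsetP => // hn; case h: (adjl _ _ _) => //; case: hn.
have /andP[_ /(coded_ends hc)[v hv]] := adjl_ends h.
by exists v; rewrite ?inE //; apply/val_inj.
Qed.

(** For [L >= 2] every name in the list has a neighbour in it, hence is an edge end and names a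
    vertex; a singleton list could consist of a name that no vertex bears. *)
Lemma clique_number_ge g es lab L : @coded g es lab -> (2 <= L)%N -> hascl L es ->
  (L <= clique_number g)%N.
Proof.
move=> hc L2 /asboolP[A [uA sA hA]]; have [inj _ _] := hc.
have inA s : s \in A -> exists v, s = lab v.
  move=> hs; have : (0 < size (rem s A))%N by rewrite size_rem // -subn1 subn_gt0 (leq_trans L2).
  case e: (rem s A) => [//|r l] _.
  have : r \in rem s A by rewrite e mem_head.
  rewrite (rem_filter _ uA) mem_filter => /andP[/= ne hr].
  rewrite eq_sym in ne.
  by have /andP[/(coded_ends hc)] := adjl_ends (hA s r hs hr ne).
pose B := [set v | lab v \in A].
apply: (@leq_trans #|B|); last first.
  apply: clique_card_le; apply/cliqueP => u v; rewrite !inE => hu hv ne.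
  by rewrite (coded_adj u v hc); apply: hA; rewrite // (inj_eq inj).
apply: (leq_trans sA); rewrite cardE -(size_map lab); apply: uniq_leq_size => // s hs.
have [v hv] := inA s hs; apply/mapP; exists v => //.
by rewrite mem_enum inE -hv.
Qed.

End Labelling.

(** * From the chain to the process *)

Section GraphSteps.
Variable R : realType.
Implicit Types (g : mgraph) (es : seq (nat * nat)).

Lemma sum_deg_law g (F : 'I_(nv g) -> R) :
  \sum_v deg_law R v * F v =
  (\sum_(e <- edges g) (F e.1 + F e.2)) / (size (edges g)).*2%:R.
Proof.
have aux (H : 'I_(nv g) -> R) :
    \sum_v (deg v)%:R * H v = \sum_(e <- edges g) (H e.1 + H e.2).
  under eq_bigr => v _ do rewrite /deg natr_sum mulr_suml.
  rewrite exchange_big /=; apply: eq_bigr => e _.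
  under eq_bigr => v _ do rewrite natrD mulrDl.
  rewrite big_split /=; congr (_ + _).
    rewrite (bigD1 e.1) //= eqxx mul1r big1 ?addr0 // => v ne.
    by rewrite eq_sym (negPf ne) mul0r.
  rewrite (bigD1 e.2) //= eqxx mul1r big1 ?addr0 // => v ne.
  by rewrite eq_sym (negPf ne) mul0r.
have tot : (\sum_(v < nv g) deg v)%:R = (size (edges g)).*2%:R :> R.
  rewrite natr_sum -[LHS]mulr1 mulr_suml (aux (fun=> 1)).
  by rewrite big_const_seq count_predT iter_addr addr0 -muln2 mulnC mulrnA.
rewrite -(aux F) mulr_suml; apply: eq_bigr => v _.
by rewrite /deg_law tot mulrAC.
Qed.

Lemma coded_avg g es lab (F : nat -> R) : @coded g es lab ->
  avg es F = \sum_v deg_law R v * F (lab v).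
Proof.
move=> [_ eE _]; rewrite sum_deg_law /avg eE size_map; congr (_ / _).
rewrite /ends; elim: (edges g) => [|e l IH]; first by rewrite !big_nil.
by rewrite /= !big_cons IH addrA.
Qed.

(** Endpoint types depend on the graph; forgetting them lets an equality of graphs be projected to
    an equality of plain lists. *)
Definition raw_edges g : seq (nat * nat) :=
  [seq (val e.1, val e.2) | e <- edges g].

Lemma vertex_step_inj g : injective (@vertex_step g).
Proof. by move=> u v /(congr1 raw_edges) [] /val_inj. Qed.

Lemma edge_step_inj g :
  injective (fun p : 'I_(nv g) * 'I_(nv g) => edge_step p.1 p.2).
Proof.
by move=> [a b] [c d] /= /(congr1 raw_edges) [] /val_inj -> /val_inj ->.
Qed.

Lemma step_prob_vertex g (v : 'I_(nv g)) : step_prob R true g (vertex_step v) = deg_law R v.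
Proof.
rewrite /step_prob (bigD1 v) //= eqxx mulr1 big1 ?addr0 // => u ne.
by rewrite (inj_eq (@vertex_step_inj g)) eq_sym (negPf ne) mulr0.
Qed.

Lemma step_prob_edge g (u v : 'I_(nv g)) :
  step_prob R false g (edge_step u v) = deg_law R u * deg_law R v.
Proof.
rewrite /step_prob pair_bigA /= (bigD1 (u, v)) //= eqxx mulr1 big1 ?addr0 //.
move=> p ne; rewrite -[edge_step u v]/(edge_step (u, v).1 (u, v).2).
by rewrite (inj_eq (@edge_step_inj g)) eq_sym (negPf ne) mulr0.
Qed.

Lemma coded_edge_step g es lab u v : @coded g es lab ->
  @coded (edge_step u v) ((lab u, lab v) :: es) lab.
Proof. by move=> [inj eE hl]; split=> //= [|x]; [rewrite eE|apply: leqW]. Qed.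

(** Old indices keep their labels; the one index outside ['I_(nv g)], the new vertex, gets the
    default [size es], its birth time. *)
Definition lab_vertex_step g es (lab : 'I_(nv g) -> nat) (i : 'I_(nv g).+1) : nat :=
  oapp lab (size es) (insub (val i)).

Lemma coded_vertex_step g es lab v : @coded g es lab ->
  @coded (vertex_step v) ((size es, lab v) :: es) (lab_vertex_step es lab).
Proof.
move=> [inj eE hl].
have lw (u : 'I_(nv g)) h : lab_vertex_step es lab (widen_ord h u) = lab u.
  by rewrite /lab_vertex_step /= valK.
have lm : lab_vertex_step es lab ord_max = size es.
  by rewrite /lab_vertex_step insubF //= ltnn.
split=> [x y||x].
- rewrite /lab_vertex_step; case: insubP => [a _ ha|nx]; case: insubP => [b _ hb|ny] /=.
  + by move=> /inj ab; apply/val_inj; rewrite -ha -hb ab.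
  + by move=> h; have := hl a; rewrite h ltnn.
  + by move=> h; have := hl b; rewrite -h ltnn.
  + move=> _; apply/val_inj => /=; have := ltn_ord x; have := ltn_ord y.
    by move: nx ny; rewrite -!leqNgt !ltnS => h1 h2 h3 h4;
      apply/eqP; rewrite eqn_leq (leq_trans h4 h2) (leq_trans h3 h1).
- rewrite /= lm lw; congr (_ :: _); rewrite {1}eE -map_comp.
  by apply: eq_map => e /=; rewrite !lw.
- rewrite /lab_vertex_step; case: insubP => [a _ _|_] /=; first exact: leqW.
  exact: ltnSn.
Qed.

End GraphSteps.

Section ProcessLowerBound.
Local Open Scope classical_set_scope.
Local Open Scope ring_scope.
Variables (R : realType) (d : measure_display) (T : measurableType d).
Variables (P : probability T R) (f : R -> R).
Variables (Z : nat -> T -> bool) (G : nat -> T -> mgraph).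
Hypothesis proc : edge_step_process P f Z G.

Let pr (A : set T) : R := fine (P A).

Lemma prE A : measurable A -> P A = (pr A)%:E.
Proof. by move=> mA; rewrite /pr fineK // fin_num_measure. Qed.

Lemma pr_ge0 A : 0 <= pr A.
Proof. by rewrite /pr fine_ge0. Qed.

Lemma prDI A B : measurable A -> measurable B ->
  pr A = pr (A `\` B) + pr (A `&` B).
Proof.
move=> mA mB; apply: EFin_inj; rewrite EFinD -!prE //.
- exact: measureDI.
- exact: measurableI.
- exact: measurableD.
Qed.

Lemma pr_sum_le (I : eqType) (r : seq I) (F : I -> set T) (B : set T) :
  uniq r -> measurable B -> (forall i, measurable (F i)) ->
  (forall i, F i `<=` B) -> (forall i j, i != j -> F i `&` F j = set0) ->
  \sum_(i <- r) pr (F i) <= pr B.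
Proof.
move=> + mB mF FB dF.
have : forall i, i \in r -> F i `<=` B by [].
elim: r B mB {FB} => [|i r IH] B mB FB ur; first by rewrite big_nil pr_ge0.
have /= /andP[ni ur'] := ur.
rewrite big_cons (prDI mB (mF i)) addrC; apply: lerD; last first.
  by rewrite (_ : B `&` F i = F i) //; apply/setIidPr/FB; rewrite mem_head.
apply: IH => //; first exact: measurableD.
move=> j jr w Fj; split; first by apply: FB Fj; rewrite inE jr orbT.
move=> Fi; have ne : i != j by apply: contraNneq ni => ->.
by have : (F i `&` F j) w by []; rewrite dF.
Qed.

Lemma measurable_Z i b : (0 < i)%N -> measurable [set w | Z i w = b].
Proof.
move=> i0; have [[mZ _ _] _ _ _] := proc.
case: b; first exact: mZ.
rewrite (_ : [set w | _] = ~` [set w | Z i w]); first exact/measurableC/mZ.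
by apply/seteqP; split => w /=; case: (Z i w).
Qed.

Lemma measurable_G t g : measurable [set w | G t w = g].
Proof. by have [_ mG _ _] := proc. Qed.

Lemma measurable_history n t z g : measurable (history Z G n t z g).
Proof.
rewrite (_ : history Z G n t z g =
  \bigcap_(i in [set i : nat | (0 < i <= n)%N]) [set w | Z i w = z i] `&`
  \bigcap_(i in [set i : nat | (i <= t)%N]) [set w | G i w = g i]); last first.
  by apply/seteqP; split => w [h1 h2]; split => i hi; [exact: h1|exact: h2|exact: h1|exact: h2].
apply: measurableI; apply: bigcap_measurableType => i /=.
  by case/andP => i0 _; apply: measurable_Z.
by move=> _; apply: measurable_G.
Qed.

(** [mgraph] is countable, so every property of [G_t] is a countable union of the measurable
    fibres. *)
Lemma measurable_G_in t (A : set mgraph) : measurable [set w | A (G t w)].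
Proof.
rewrite (_ : [set w | _] = \bigcup_(n in [set n | exists2 g, A g & n = pickle g])
    [set w | pickle (G t w) = n]).
  apply: bigcup_measurable => n [g _ ->].
  rewrite (_ : [set w | _] = [set w | G t w = g]); first exact: measurable_G.
  by apply/seteqP; split => w /=; [apply: (pcan_inj (@pickleK _))|move=> ->].
apply/seteqP; split => w /=.
  by move=> h; exists (pickle (G t w)) => //; exists (G t w).
by case=> n [g Ag ->] /= /(pcan_inj (@pickleK _)) ->.
Qed.

Definition bern b t : R := if b then f t%:R else 1 - f t%:R.

Lemma Z_law b t : (0 < t)%N -> P [set w | Z t w = b] = (bern b t)%:E.
Proof.
move=> t0; have [[mZ pZ _] _ _ _] := proc.
case: b => /=; first exact: pZ.
rewrite (_ : [set w | _] = ~` [set w | Z t w]); last first.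
  by apply/seteqP; split => w /=; case: (Z t w).
by rewrite probability_setC ?pZ //; apply: mZ.
Qed.

(** The next vertex-or-edge choice is independent of the graphs so far. Peeling off [G_{t+1}] gives
    the same factor [step_prob] whether [n] or [n + 1] values of [Z] are fixed, and with no graph
    left this is the independence of the [Z_i]. *)
Lemma history_next n t z g : (t <= n)%N ->
  P (history Z G n.+1 t z g) = (P (history Z G n t z g) * (bern (z n.+1) n.+1)%:E)%E.
Proof.
have [[_ _ indZ] _ G0 markov] := proc.
elim: t => [_|t IH tn].
  have [g0|g0] := eqVneq (g 0%N) one_loop; last first.
    have e m : history Z G m 0 z g = set0.
      apply/seteqP; split => // w [_ /(_ 0%N (leqnn _))]; rewrite G0 => h.
      by rewrite h eqxx in g0.
    by rewrite !e measure0 mul0e.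
  have e m : history Z G m 0 z g = [set w | {in iota 1 m, forall i, Z i w = z i}].
    apply/seteqP; split => w.
      by move=> [h _] i; rewrite mem_iota add1n ltnS => hi; apply: h.
    move=> h; split; last by move=> i; rewrite leqn0 => /eqP ->; rewrite G0.
    by move=> i hi; apply: h; rewrite mem_iota add1n ltnS.
  rewrite !e !indZ ?iota_uniq ?mem_iota //.
  have -> : iota 1 n.+1 = iota 1 n ++ [:: n.+1] by rewrite -[in LHS](addn1 n) iotaD add1n.
  by rewrite big_cat big_seq1 Z_law.
have e m : history Z G m t.+1 z g =
    history Z G m t z g `&` [set w | G t.+1 w = g t.+1].
  apply/seteqP; split => w.
    by move=> [h1 h2]; split; [split => // i hi; apply/h2/leqW|apply: h2].
  move=> [[h1 h2] h3]; split => // i; rewrite leq_eqVlt => /orP[/eqP ->//|].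
  by rewrite ltnS; apply: h2.
rewrite !e !markov ?IH ?(ltnW tn) //; last exact: ltnW.
by rewrite -!muleA; congr (_ * _)%E; rewrite muleC.
Qed.

Definition upd (S : Type) (h : nat -> S) k x : nat -> S :=
  fun i => if i == k then x else h i.

Lemma history_updZ k z g b :
  history Z G k.+1 k (upd z k.+1 b) g =
  history Z G k k z g `&` [set w | Z k.+1 w = b].
Proof.
apply/seteqP; split => w.
  move=> [h1 h2]; split; last by rewrite /= h1 /upd ?eqxx // ltnSn.
  split => // i /andP[i0 ik]; rewrite h1; last by rewrite i0 leqW.
  by rewrite /upd ltn_eqF.
move=> [[h1 h2] h3]; split => // i /andP[i0]; rewrite leq_eqVlt /upd.
by case: eqP => [-> _|_ /= ik]; [exact: h3|rewrite h1 // i0].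
Qed.

Lemma history_updG n k z g h :
  history Z G n k.+1 z (upd g k.+1 h) =
  history Z G n k z g `&` [set w | G k.+1 w = h].
Proof.
apply/seteqP; split => w.
  move=> [h1 h2]; split; last by rewrite /= h2 /upd ?eqxx.
  by split => // i ik; rewrite h2 ?leqW // /upd ltn_eqF.
move=> [[h1 h2] h3]; split => // i; rewrite leq_eqVlt /upd.
by case: eqP => [-> _|_ /= ik]; [exact: h3|rewrite h2].
Qed.

(** [c i] is the conditional probability of the next graph [h i], and [val i] a lower bound for that
    of [X] afterwards. Injectivity of [h] makes the events disjoint, so their probabilities add up
    below the total. *)
Lemma branch (I : finType) (h : I -> mgraph) (c val : I -> R) k z g b X :
  injective h -> measurable X ->
  (forall i, step_prob R b (g k) (h i) = c i) ->
  (forall i, let H := history Z G k.+1 k.+1 (upd z k.+1 b) (upd g k.+1 (h i)) in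
     pr H * val i <= pr (H `&` X)) ->
  pr (history Z G k k z g) * (bern b k.+1 * \sum_i c i * val i) <=
  pr (history Z G k.+1 k (upd z k.+1 b) g `&` X).
Proof.
move=> hinj mX hc hv; have [_ _ _ markov] := proc.
set z' := upd z k.+1 b in hv *; set H := history Z G k.+1 k z' g.
have mH : measurable H by exact: measurable_history.
have pH : pr H = pr (history Z G k k z g) * bern b k.+1.
  apply: EFin_inj; rewrite EFinM -!prE //; last exact: measurable_history.
  rewrite /H history_next // {2}/z' /upd eqxx; congr (P _ * _)%E.
  apply/seteqP; split => w [h1 h2]; split => // i /andP[i0 ik].
    by rewrite h1 ?i0 // /z' /upd ltn_eqF.
  by rewrite h1 ?i0 // /z' /upd ltn_eqF.
rewrite mulrA -pH mulr_sumr.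
pose F i := H `&` [set w | G k.+1 w = h i] `&` X.
apply: (@le_trans _ _ (\sum_i pr (F i))).
  apply: ler_sum => i _; have := hv i; rewrite /= history_updG -/H; apply: le_trans.
  rewrite mulrA (_ : pr (H `&` _) = pr H * c i) //.
  apply: EFin_inj; rewrite EFinM -!prE //; last first.
    by apply: measurableI => //; apply: measurable_G.
  by rewrite /H markov // -hc {2}/z' /upd eqxx.
apply: pr_sum_le; rewrite ?index_enum_uniq //.
- exact: measurableI.
- by move=> i; apply: measurableI => //; apply: measurableI => //; apply: measurable_G.
- by move=> i w [[]].
- move=> i j ne; apply/seteqP; split => // w [[[_ /= e1] _] [[_ /= e2] _]].
  by move/eqP: ne; apply; apply: hinj; rewrite -e1.
Qed.

Let w (m : nat) : R := f m%:R.

(** Induction on the remaining steps, conditioning on the complete history. As only a lower bound is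
    claimed, the branches need not be shown to exhaust the event. *)
Lemma history_lower (phi : pred (seq (nat * nat))) (A : set mgraph) n k z g es lab :
  (forall g' es' lab', @coded g' es' lab' -> size es' = (k + n).+1 -> phi es' -> A g') ->
  @coded (g k) es lab -> size es = k.+1 ->
  pr (history Z G k k z g) * Ex w n (fun e => (phi e)%:R) es <=
  pr (history Z G k k z g `&` [set w | A (G (k + n)%N w)]).
Proof.
elim: n k z g es lab => [|n IH] k z g es lab hA hc hs.
  rewrite addn0 /=; case hphi : (phi es); last by rewrite mulr0 pr_ge0.
  rewrite mulr1 (_ : _ `&` _ = history Z G k k z g) //.
  apply/setIidPl => x [_ /(_ k (leqnn _)) h] /=; rewrite h.
  by apply: hA hc _ hphi; rewrite addn0.
set X := [set _ | _]; have mX : measurable X by exact: measurable_G_in.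
set H := history Z G k k z g.
have mH : measurable H by exact: measurable_history.
pose V := Ex w n (fun e => (phi e)%:R).
have hA' g' es' lab' : @coded g' es' lab' -> size es' = (k.+1 + n).+1 -> phi es' -> A g'.
  by rewrite addSnnS; apply: hA.
have hb1 := @branch _ (@vertex_step (g k)) (@deg_law R (g k))
  (fun v => V ((size es, lab v) :: es)) k z g true X (@vertex_step_inj (g k)) mX
  (@step_prob_vertex R (g k)).
have hb0 := @branch _ (fun p : 'I_(nv (g k)) * 'I_(nv (g k)) => edge_step p.1 p.2)
  (fun p => deg_law R p.1 * deg_law R p.2)
  (fun p => V ((lab p.1, lab p.2) :: es)) k z g false X (@edge_step_inj (g k)) mX
  (fun p => @step_prob_edge R (g k) p.1 p.2).
have e1 : \sum_v deg_law R v * V ((size es, lab v) :: es) =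
    avg es (fun x => V ((size es, x) :: es)) by rewrite (coded_avg _ hc).
have e0 : \sum_(p : 'I_(nv (g k)) * 'I_(nv (g k)))
      deg_law R p.1 * deg_law R p.2 * V ((lab p.1, lab p.2) :: es) =
    avg es (fun x => avg es (fun y => V ((x, y) :: es))).
  rewrite (coded_avg _ hc) -(pair_bigA _ (fun u v =>
    deg_law R u * deg_law R v * V ((lab u, lab v) :: es))) /=.
  apply: eq_bigr => u _; rewrite (coded_avg _ hc) mulr_sumr.
  by apply: eq_bigr => v _; rewrite mulrA.
have w1 : w (size es) = bern true k.+1 by rewrite /w hs.
have w0 : 1 - w (size es) = bern false k.+1 by rewrite /w hs.
rewrite ExS /step -/V w0 w1.
have mHb b : measurable (history Z G k.+1 k (upd z k.+1 b) g `&` X).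
  by apply: measurableI => //; apply: measurable_history.
rewrite (_ : pr (H `&` X) = pr (history Z G k.+1 k (upd z k.+1 true) g `&` X) +
    pr (history Z G k.+1 k (upd z k.+1 false) g `&` X)); last first.
  rewrite (prDI (measurableI _ _ mH mX) (@measurable_Z k.+1 false (ltn0Sn _))).
  rewrite !history_updZ -/H; congr (pr _ + pr _); apply/seteqP; split => x /=.
  - by move=> [[hx Xx] hz]; split => //; split => //; case: (Z k.+1 x) hz.
  - by move=> [[hx hz] Xx]; rewrite hz; split.
  - by move=> [[hx Xx] hz].
  - by move=> [[hx hz] Xx].
have child b h e l : @coded h e l -> size e = k.+2 ->
    let H' := history Z G k.+1 k.+1 (upd z k.+1 b) (upd g k.+1 h) in
    pr H' * V e <= pr (H' `&` X).
  move=> hl se; rewrite /X -addSnnS.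
  have : exists l', @coded (upd g k.+1 h k.+1) e l' by rewrite /upd eqxx; exists l.
  by case=> l' hl'; apply: IH hl' _.
rewrite mulrDr; apply: lerD.
  rewrite -e1; apply: hb1 => v; apply: (child true _ _ _ (coded_vertex_step v hc)).
  by rewrite /= hs.
rewrite -e0; apply: hb0 => p.
apply: (child false _ _ _ (coded_edge_step p.1 p.2 hc)).
by rewrite /= hs.
Qed.

Lemma process_lower (phi : pred (seq (nat * nat))) (A : set mgraph) n :
  (forall g es lab, @coded g es lab -> size es = n.+1 -> phi es -> A g) ->
  ((Ex w n (fun e => (phi e)%:R) es0)%:E <= P [set x | A (G n x)])%E.
Proof.
move=> hA; have [_ _ G0 _] := proc.
have hc : @coded one_loop es0 (@nat_of_ord 1).
  by split => // i j; exact: val_inj.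
have := @history_lower phi A n 0 (fun=> true) (fun=> one_loop) es0 _ hA hc (erefl _).
have -> : history Z G 0 0 (fun=> true) (fun=> one_loop) = setT.
  apply/seteqP; split => // x _; split => i; first by case: i.
  by rewrite leqn0 => /eqP ->; rewrite G0.
rewrite setTI (prE (measurable_G_in n A)) lee_fin {1}/pr probability_setT /=.
by rewrite mul1r.
Qed.

End ProcessLowerBound.

(** * Asymptotic estimates *)

Section RegularVariation.
Local Open Scope classical_set_scope.
Local Open Scope ring_scope.
Variables (R : realType) (f : R -> R) (gamma : R).
Hypothesis f01 : forall x, 0 < x -> 0 < f x <= 1.
Hypothesis fmono : forall x y, 0 < x -> x <= y -> f y <= f x.

Lemma near_pinfty_ge (Q : R -> Prop) :
  (\forall t \near +oo, Q t) -> exists2 x0 : R, 1 <= x0 & forall x, x0 <= x -> Q x.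
Proof.
move=> [M [_ hM]]; exists (Num.max M 0 + 1); first by rewrite lerDr le_max lexx orbT.
move=> x hx; apply: hM; apply: lt_le_trans hx.
by rewrite ltr_pwDr // le_max lexx.
Qed.

Lemma ltr_powR2 (a b : R) : a < b -> 2 `^ a < 2 `^ b :> R.
Proof.
move=> ab; rewrite /powR pnatr_eq0 /= ltr_expR ltr_pM2r //.
by rewrite ln_gt0 // ltr1n.
Qed.

Hypothesis frv : regularly_varying f (- gamma).

(* Only the ratio f (2 t) / f t is needed: the bounds propagate along dyadic
   scales. *)
Lemma rv_upper (g : R) : 0 <= g < gamma ->
  exists2 C : R, 0 < C & forall x, 1 <= x -> f x <= C * x `^ (- g).
Proof.
move=> /andP[g0 gg].
have h2 : 2 `^ (- gamma) < 2 `^ (- g) :> R by apply: ltr_powR2; rewrite ltrN2.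
have [x0 x01 hx0] := near_pinfty_ge (cvgr_lt _ (frv (ltr0Sn R 1)) _ h2).
have x00 : 0 < x0 by lra.
(* With this [C] the bound on [[1, 2 x0]] follows from [f <= 1]; each doubling beyond it gains a
   factor [2^(-g)]. *)
pose C := (2 * x0) `^ g.
have C0 : 0 < C by apply: powR_gt0; lra.
exists C => //.
have small x : 1 <= x -> x <= 2 * x0 -> f x <= C * x `^ (- g).
  move=> x1 hx; have xp : 0 < x by lra.
  apply: (@le_trans _ _ 1); first by case/andP: (f01 xp).
  rewrite powRN ler_pdivlMr ?powR_gt0 // mul1r.
  by apply: ge0_ler_powR; rewrite // nnegrE; lra.
have ind n x : 1 <= x -> x <= 2 ^+ n.+1 * x0 -> f x <= C * x `^ (- g).
  elim: n x => [|n IH] x x1 hx; first by apply: small; rewrite // expr1 in hx *.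
  have [hs|hs] := leP x (2 * x0); first exact: small.
  have xp : 0 < x by lra.
  have xh : x0 <= x / 2 by lra.
  have /andP[fp _] : 0 < f (x / 2) <= 1 by apply: f01; lra.
  have := hx0 _ xh; rewrite ltr_pdivrMr // mulrCA mulfV ?mulr1 // => /ltW h.
  apply: (le_trans h).
  have h' : f (x / 2) <= C * (x / 2) `^ (- g).
    by apply: IH; [lra|move: hx; rewrite exprS; lra].
  apply: (le_trans (ler_wpM2l (powR_ge0 _ _) h')).
  rewrite mulrCA -powRM ?divr_ge0 //; last by rewrite ltW.
  by rewrite mulrCA mulfV // mulr1.
move=> x x1; apply: (ind (Num.truncn x)) => //.
have /andP[_ hx] := truncn_itv (ltW (lt_le_trans ltr01 x1)).
apply: (le_trans (ltW hx)).
apply: (@le_trans _ _ (2 ^+ (Num.truncn x).+1)); last by rewrite ler_peMr // exprn_ge0.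
by rewrite -natrX ler_nat ltnW // ltn_expl.
Qed.

Lemma rv_lower (h : R) : 0 <= h -> gamma < h ->
  exists2 c : R, 0 < c & forall x, 1 <= x -> c * x `^ (- h) <= f x.
Proof.
move=> h0 gh.
have h2 : 2 `^ (- h) < 2 `^ (- gamma) :> R by apply: ltr_powR2; rewrite ltrN2.
have [x0 x01 hx0] := near_pinfty_ge (cvgr_gt _ (frv (ltr0Sn R 1)) _ h2).
have x00 : 0 < x0 by lra.
have /andP[c0 _] : 0 < f (2 * x0) <= 1 by apply: f01; lra.
(* By monotonicity [f >= c] on [[1, 2 x0]], which starts the same induction by halving the
   argument. *)
pose c := f (2 * x0).
exists c => //.
have small x : 1 <= x -> x <= 2 * x0 -> c * x `^ (- h) <= f x.
  move=> x1 hx; have xp : 0 < x by lra.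
  apply: (@le_trans _ _ c); last by apply: fmono.
  rewrite ler_piMr ?(ltW c0) // powRN invf_le1 ?powR_gt0 //.
  apply: (@le_trans _ _ (1 `^ h)); first by rewrite powR1.
  by apply: ge0_ler_powR; rewrite // nnegrE; lra.
have ind n x : 1 <= x -> x <= 2 ^+ n.+1 * x0 -> c * x `^ (- h) <= f x.
  elim: n x => [|n IH] x x1 hx; first by apply: small; rewrite // expr1 in hx *.
  have [hs|hs] := leP x (2 * x0); first exact: small.
  have xp : 0 < x by lra.
  have xh : x0 <= x / 2 by lra.
  have /andP[fp _] : 0 < f (x / 2) <= 1 by apply: f01; lra.
  have := hx0 _ xh; rewrite ltr_pdivlMr // mulrCA mulfV ?mulr1 // => /ltW h1.
  apply: le_trans h1.
  have h' : c * (x / 2) `^ (- h) <= f (x / 2).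
    by apply: IH; [lra|move: hx; rewrite exprS; lra].
  apply: le_trans (ler_wpM2l (powR_ge0 _ _) h').
  rewrite mulrCA -powRM ?divr_ge0 //; last by rewrite ltW.
  by rewrite mulrCA mulfV // mulr1.
move=> x x1; apply: (ind (Num.truncn x)) => //.
have /andP[_ hx] := truncn_itv (ltW (lt_le_trans ltr01 x1)).
apply: (le_trans (ltW hx)).
apply: (@le_trans _ _ (2 ^+ (Num.truncn x).+1)); last by rewrite ler_peMr // exprn_ge0.
by rewrite -natrX ler_nat ltnW // ltn_expl.
Qed.

End RegularVariation.

Section Eventually.
Local Open Scope classical_set_scope.
Local Open Scope ring_scope.
Variable R : realType.
Implicit Types (a b c C : R) (t : nat).

Lemma near_natr_ge C : \forall t \near \oo, C <= t%:R.
Proof. exact: nbhs_infty_ger. Qed.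

Lemma near_powR a b C : a < b ->
  \forall t \near \oo, C * t%:R `^ a <= t%:R `^ b.
Proof.
move=> ab; have ba : 0 < b - a by lra.
pose D := Num.max C 0; have D0 : 0 <= D by rewrite le_max lexx orbT.
near=> t.
have t1 : 1 <= t%:R :> R by near: t; exact: near_natr_ge.
have tD : D `^ (b - a)^-1 <= t%:R by near: t; exact: near_natr_ge.
have t0 : 0 < t%:R :> R by lra.
have -> : b = a + (b - a) by ring.
rewrite powRD ?(gt_eqF t0) ?implybT // mulrC ler_pM2l ?powR_gt0 //.
apply: (@le_trans _ _ D); first by rewrite le_max lexx.
have -> : D = (D `^ (b - a)^-1) `^ (b - a) by rewrite -powRrM mulVf ?powRr1 // gt_eqF.
by apply: ge0_ler_powR; rewrite ?nnegrE ?powR_ge0 // ltW.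
Unshelve. all: by end_near.
Qed.

Lemma near_powR_ge b C : 0 < b -> \forall t \near \oo, C <= t%:R `^ b.
Proof.
move=> b0; have h := near_powR C b0.
near=> t; have : C * t%:R `^ 0 <= t%:R `^ b by near: t.
by rewrite powRr0 mulr1.
Unshelve. all: by end_near.
Qed.

Lemma ln_le_powR (x e : R) : 0 < e -> 0 < x -> ln x <= e^-1 * x `^ e.
Proof.
move=> e0 x0; rewrite ler_pdivlMl // -ln_powR.
have y0 : 0 < x `^ e by apply: powR_gt0.
have h : ln (1 + (x `^ e - 1)) <= x `^ e - 1 by apply: le_ln1Dx; lra.
have e1 : 1 + (x `^ e - 1) = x `^ e by ring.
by rewrite e1 in h; lra.
Qed.

(** Converts decay like a power of [t] into a share [1 / N] of the allowed failure probability. *)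
Lemma near_inv_ln c C N : 0 < c -> 0 < N ->
  \forall t \near \oo, C * t%:R `^ (- c) <= 1 / (N * ln t%:R).
Proof.
move=> c0 N0.
have c2 : 0 < c / 2 by lra.
pose D := Num.max C 0; have D0 : 0 <= D by rewrite le_max lexx orbT.
near=> t.
have t2 : 2 <= t%:R :> R by near: t; exact: near_natr_ge.
have t0 : 0 < t%:R :> R by lra.
have l0 : 0 < ln t%:R :> R by rewrite ln_gt0 //; lra.
rewrite powRN ler_pdivlMr ?mulr_gt0 // mulrAC ler_pdivrMr ?powR_gt0 // mul1r.
apply: (@le_trans _ _ (D * (N * ln t%:R))).
  by apply: ler_wpM2r; rewrite ?le_max ?lexx // mulr_ge0 ?ltW.
apply: (@le_trans _ _ (D * N * (c / 2)^-1 * t%:R `^ (c / 2))).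
  rewrite -!mulrA; apply: ler_wpM2l => //; apply: ler_wpM2l; first exact: ltW.
  exact: ln_le_powR.
near: t; apply: near_powR; lra.
Unshelve. all: by end_near.
Qed.

Lemma near_expR_powR a b c : 0 < a -> 0 < c ->
  \forall t \near \oo, expR (- (c * t%:R `^ a)) <= t%:R `^ (- b).
Proof.
move=> a0 c0; have a2 : 0 < a / 2 by lra.
have b1 : 0 < `|b| + 1 by rewrite ltr_wpDl.
near=> t.
have t1 : 1 <= t%:R :> R by near: t; exact: near_natr_ge.
have t0 : 0 < t%:R :> R by lra.
rewrite {2}/powR (gt_eqF t0) ler_expR mulNr lerN2.
have l0 : 0 <= ln t%:R :> R by rewrite ln_ge0.
apply: (@le_trans _ _ (`|b| * ln t%:R)); first by apply: ler_wpM2r; rewrite // ler_norm.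
apply: (@le_trans _ _ (`|b| * ((a / 2)^-1 * t%:R `^ (a / 2)))).
  by apply: ler_wpM2l => //; apply: ln_le_powR.
rewrite mulrA -ler_pdivrMl // mulrA.
near: t; apply: near_powR; lra.
Unshelve. all: by end_near.
Qed.

End Eventually.

(** * The three bad events have small probability *)

Section WithHighProbability.
Local Open Scope classical_set_scope.
Local Open Scope ring_scope.
Variables (R : realType) (f : R -> R) (gamma : R).
Hypothesis gamma01 : 0 <= gamma < 1.
Hypothesis f01 : forall x, 0 < x -> 0 < f x <= 1.
Hypothesis fmono : forall x y, 0 < x -> x <= y -> f y <= f x.
Hypothesis f0 : f x @[x --> +oo] --> (0 : R).
Hypothesis frv : regularly_varying f (- gamma).

Let w (m : nat) : R := f m%:R.
Let beta : R := 1 - gamma.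

Lemma vertex_prob01 m : (0 < m)%N -> 0 <= w m <= 1.
Proof.
move=> m0; have /f01/andP[h1 h2] : 0 < m%:R :> R by rewrite ltr0n.
by rewrite ltW.
Qed.

Lemma vertex_prob_mono m n : (0 < m <= n)%N -> w n <= w m.
Proof. by case/andP => m0 mn; apply: fmono; rewrite ?ltr0n // ler_nat. Qed.

Lemma vertex_prob_small (k : R) : 0 < k ->
  exists m0, forall m, (m0 <= m)%N -> w m <= k /\ 1 <= k * m%:R.
Proof.
move=> k0.
have [x0 x01 hx0] := near_pinfty_ge (cvgr_lt _ f0 _ k0).
exists (maxn (Num.truncn x0).+1 (Num.truncn k^-1).+1) => m.
rewrite geq_max => /andP[h1 h2].
have hx : x0 <= m%:R.
  by rewrite ltW // -truncn_lt_nat // (le_trans ler01).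
have hk : k^-1 <= m%:R by rewrite ltW // -truncn_lt_nat // invr_ge0 ltW.
split; first exact/ltW/hx0.
by rewrite -ler_pdivrMl // mulr1.
Qed.

Lemma powRDE (x a b : R) : 0 < x -> x `^ a * x `^ b = x `^ (a + b).
Proof. by move=> x0; rewrite powRD // (gt_eqF x0) implybT. Qed.

Lemma powR_inv_base (x a : R) : 0 < x -> x^-1 `^ a = x `^ (- a).
Proof. by move=> x0; rewrite -powR_inv1 ?ltW // -powRrM mulN1r. Qed.

(** When [gamma <= eps] no positive exponent is guaranteed; then [g = 0] with the bound [f <= 1] is
    within [eps] already. *)
Lemma upper_exponent (eps : R) : 0 < eps ->
  exists g C : R, [/\ 0 <= g <= 1, 1 - g <= beta + eps, 0 < C &
    forall x, 1 <= x -> f x <= C * x `^ (- g)].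
Proof.
move=> e0; have [hg|hg] := ltP 0 (gamma - eps); last first.
  exists 0, 1; split => //; rewrite ?lexx ?ler01 //; first by rewrite /beta; lra.
  move=> x x1; rewrite oppr0 powRr0 mulr1.
  by case/andP: (f01 (lt_le_trans ltr01 x1)).
have hg' : 0 <= gamma - eps < gamma by lra.
have [C C0 hC] := rv_upper f01 frv hg'.
have /andP[ga0 ga1] := gamma01.
by exists (gamma - eps), C; split => //; [apply/andP; split; lra|rewrite /beta; lra].
Qed.

Lemma edges_upper (eps N : R) : 0 < eps <= 1 -> 0 < N ->
  \forall t \near \oo,
    Ex w t (fun e => (t%:R `^ (beta + eps) < (npairs e)%:R)%R%:R) es0 <=
    1 / (N * ln t%:R).
Proof.
move=> /andP[e0 e1] N0; have /andP[ga0 ga1] := gamma01.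
have e4 : 0 < eps / 4 by lra.
have [g [C [hg hgb C0 hC]]] := upper_exponent e4.
have [g0 g1] := andP hg.
(* The 1 covers vertex 0, and [2 C] pays for the shift from [i] to [i + 1] in the power. *)
pose Cw : R := Num.max 1 (2 * C).
have Cw1 : 1 <= Cw by rewrite le_max lexx.
have Cw0 : 0 <= Cw by exact: le_trans Cw1.
have wzC i : wz w i <= Cw * i.+1%:R `^ (- g).
  case: i => [|i]; first by rewrite powR1 mulr1.
  rewrite /wz /=; apply: (@le_trans _ _ (C * i.+1%:R `^ (- g))).
    by apply: hC; rewrite ler1n.
  apply: (@le_trans _ _ (2 * C * i.+2%:R `^ (- g))); last first.
    by apply: ler_wpM2r; rewrite ?powR_ge0 // le_max lexx orbT.
  rewrite -mulrA mulrCA; apply: ler_wpM2l; first exact: ltW.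
  rewrite !powRN ler_pdivlMr ?powR_gt0 // mulrC ler_pdivrMr ?powR_gt0 //.
  apply: (@le_trans _ _ ((2 * i.+1%:R) `^ g)).
    apply: ge0_ler_powR; rewrite ?nnegrE ?mulr_ge0 //.
    by rewrite -natrM ler_nat mul2n -addnn addSn ltnS leq_addl.
  rewrite powRM //; apply: ler_wpM2r; first exact: powR_ge0.
  by apply: ler1_powR; rewrite // ler1n.
(* The exponent loses [eps / 4] to [g] and [2 * eps / 8] to the squared harmonic sum, so Markov's
   inequality keeps [t^(- eps / 2)]. The power of 2 replaces [t + 1] by [2 t]. *)
pose D : R := Cw ^+ 2 * (1 + (eps / 8)^-1) ^+ 2 * 2 `^ (beta + eps / 2).
have hD := @near_inv_ln R (eps / 2) D N _ N0.
near=> t.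
have t1 : 1 <= t%:R :> R by near: t; exact: near_natr_ge.
have t0 : 0 < t%:R :> R by lra.
have hDt : D * t%:R `^ (- (eps / 2)) <= 1 / (N * ln t%:R).
  by near: t; apply: hD; lra.
apply: le_trans hDt.
set M := t%:R `^ (beta + eps); have M0 : 0 < M by apply: powR_gt0.
apply: (@le_trans _ _ (Ex w t (fun e => M^-1 * (npairs e)%:R) es0)).
  apply: (Ex_mono vertex_prob01) => // e _ _; case: ltP => h /=.
    by rewrite mulrC ler_pdivlMr // mul1r ltW.
  by rewrite mulr_ge0 // invr_ge0 ltW.
rewrite ExZ ler_pdivrMl //.
apply: (le_trans (npairs_mean vertex_prob01 t hg wzC)).
set U : R := t.+1%:R; set H := \sum_(_ < _) _.
have U1 : 1 <= U by rewrite ler1n.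
have U0 : 0 < U by lra.
have H0 : 0 <= H by apply: sumr_ge0 => i _; rewrite invr_ge0.
have HU : H <= (1 + (eps / 8)^-1) * U `^ (eps / 8).
  have e8 : 0 < eps / 8 by lra.
  apply: (le_trans (harmonic_le R t)); rewrite mulrDl mul1r; apply: lerD.
    apply: (@le_trans _ _ (1 `^ (eps / 8))); first by rewrite powR1.
    by apply: ge0_ler_powR; rewrite ?nnegrE // ltW.
  exact: ln_le_powR.
apply: (@le_trans _ _ (Cw ^+ 2 * U `^ (beta + eps / 4) *
    ((1 + (eps / 8)^-1) * U `^ (eps / 8)) ^+ 2)).
  apply: ler_pM; rewrite ?mulr_ge0 ?exprn_ge0 ?powR_ge0 //.
    by apply: ler_wpM2l; rewrite ?exprn_ge0 // ler_powR.
  by rewrite ler_pXn2r // nnegrE (le_trans H0).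
have -> : Cw ^+ 2 * U `^ (beta + eps / 4) * ((1 + (eps / 8)^-1) * U `^ (eps / 8)) ^+ 2 =
    Cw ^+ 2 * (1 + (eps / 8)^-1) ^+ 2 * U `^ (beta + eps / 2).
  rewrite exprMn [(U `^ _) ^+ 2]expr2 powRDE // mulrACA powRDE //.
  by congr (_ * _ `^ _); field.
have -> : M * (D * t%:R `^ (- (eps / 2))) =
    Cw ^+ 2 * (1 + (eps / 8)^-1) ^+ 2 * (2 `^ (beta + eps / 2) * t%:R `^ (beta + eps / 2)).
  rewrite [LHS](_ : _ = Cw ^+ 2 * (1 + (eps / 8)^-1) ^+ 2 *
    (2 `^ (beta + eps / 2) * (M * t%:R `^ (- (eps / 2))))); last by rewrite /D; ring.
  by rewrite /M powRDE //; congr (_ * (_ * _ `^ _)); field.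
apply: ler_wpM2l; first by rewrite mulr_ge0 // sqr_ge0.
rewrite -powRM //; apply: ge0_ler_powR; rewrite ?nnegrE; [rewrite /beta; lra|lra|lra|].
by rewrite /U -natr1; lra.
Unshelve. all: by end_near.
Qed.

Lemma half_bounds t : t%:R / 2 <= (t./2).+1%:R :> R /\ t%:R / 2 <= (t - t./2)%N%:R :> R.
Proof.
have e := odd_double_half t.
split; rewrite ler_pdivrMr // -natrM ler_nat -{1}e -muln2; last first.
  rewrite -[X in (X - _)%N]e -muln2; case: (odd t) => /=; lia.
by case: (odd t) => /=; lia.
Qed.

Lemma expR_pow2 n : 2 ^+ n <= expR n%:R :> R.
Proof.
rewrite -[n%:R]mulr1 expRM_natl; apply: lerXn2r; rewrite ?nnegrE ?expR_ge0 //.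
by have := expR_ge1Dx (1 : R); lra.
Qed.

Lemma leaf_lower (eps N : R) : 0 < eps <= 1 -> eps < beta -> 0 < N ->
  \forall t \near \oo,
    Ex w t (fun e => ((sdeg0 e)%:R < t%:R `^ (beta - eps))%R%:R) es0 <=
    1 / (N * ln t%:R).
Proof.
move=> /andP[e0 e1] eb N0.
(* With [K = t^(1 - eta)] and [al = 1 - eta / 2], a low degree has probability of order
   [K t^(- al) = t^(- eta / 2)], and the expected gain of neighbours, of order at least
   [t^(beta - 2 eta)], still exceeds [t^(beta - eps)]. *)
pose eta := eps / 4; pose k := eta / 4.
have eta0 : 0 < eta by rewrite /eta; lra.
have eta1 : eta <= 1 / 4 by rewrite /eta; lra.
have k01 : 0 < k <= 2^-1 by apply/andP; rewrite /k; split; lra.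
have [k0 k1] := andP k01.
have [m0 hm0] := vertex_prob_small k0.
have /andP[ga0 ga1] := gamma01.
have h0 : 0 <= gamma + eta by lra.
have hg : gamma < gamma + eta by lra.
have [c c0 hc] := rv_lower f01 fmono frv h0 hg.
pose al := 1 - 2 * k.
have al0 : 0 <= al by rewrite /al; lra.
pose C : R := (2 * m0.+1%:R) `^ al / k.
have hC := @near_inv_ln R (eta / 2) C (2 * N).
have h1 := @near_inv_ln R 1 1 (2 * N) ltr01.
near=> t.
have t2 : 2 <= t%:R :> R by near: t; exact: near_natr_ge.
have t0 : 0 < t%:R :> R by exact: lt_le_trans t2.
have t0' := ltW t0.
set a := t./2; set b := (t - t./2)%N.
have tab : t = (a + b)%N.
  by rewrite /b subnKC // -[leqRHS]odd_double_half -/a -addnn addnA leq_addl.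
have [ha hb] := half_bounds t; rewrite -/a -/b in ha hb.
set x := t%:R `^ (beta - eps).
have x1 : 1 <= x by rewrite /x; near: t; apply: near_powR_ge; lra.
pose L := (Num.truncn x).+1.
have /andP[L1 L2] : (Num.truncn x)%:R <= x < L%:R by exact: truncn_itv (le_trans ler01 x1).
pose K : R := t%:R `^ (1 - eta); have K0 : 0 < K by apply: powR_gt0.
apply: (@le_trans _ _ (Ex w (a + b) (fun e => (sdeg0 e < L)%N%:R) es0)).
  rewrite -tab; apply: (Ex_mono vertex_prob01) => // e _ _; rewrite ler_nat.
  case: ltP => // h; rewrite lt0b -(ltr_nat R); exact: lt_trans L2.
apply: (le_trans (leaf_bound vertex_prob01 vertex_prob_mono _ _ _ K0)); rewrite -tab.
rewrite (_ : 1 / (N * ln t%:R) = 1 / (2 * N * ln t%:R) + 1 / (2 * N * ln t%:R)); last first.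
  have l0 : ln t%:R != 0 :> R by rewrite gt_eqF // ln_gt0 // (lt_le_trans _ t2) // ltr1n.
  by field; rewrite l0 gt_eqF.
apply: lerD.
  apply: le_trans (deg_low vertex_prob01 k01 hm0 (leq0n a) K0) _.
  apply: (@le_trans _ _ (C * t%:R `^ (- (eta / 2)))); last first.
    by near: t; apply: hC; lra.
  rewrite /wz eqxx addn0 -/al.
  apply: (@le_trans _ _ (K * (1 / k * ((2 * m0.+1%:R) * t%:R^-1) `^ al))).
    rewrite ler_pM2l // ler_pM2l ?divr_gt0 //.
    apply: ge0_ler_powR; rewrite ?nnegrE ?mulr_ge0 ?invr_ge0 //.
    rewrite [2 * _]mulrC -mulrA; apply: ler_wpM2l => //.
    by rewrite -[2]invrK -invfM lef_pV2 ?posrE ?mulr_gt0 ?invr_gt0 // mulrC.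
  rewrite powRM ?mulr_ge0 ?invr_ge0 ?(ltW t0) // powR_inv_base //.
  rewrite /C /K [leLHS](_ : _ = (2 * m0.+1%:R) `^ al / k *
    (t%:R `^ (1 - eta) * t%:R `^ (- al))); last by ring.
  rewrite powRDE // le_eqVlt; apply/orP; left; apply/eqP; congr (_ * _ `^ _).
  by rewrite /al /k; field.
apply: (@le_trans _ _ (expR (- (1 * x)))); last first.
  apply: (@le_trans _ _ (1 * t%:R `^ (-1))).
    by rewrite [leRHS]mul1r /x; near: t; apply: near_expR_powR; lra.
  by near: t; apply: h1; lra.
apply: (@le_trans _ _ (expR L%:R * expR (- (w t * K / (4 * t%:R))) ^+ b)).
  by apply: ler_wpM2r; rewrite ?exprn_ge0 ?expR_ge0 ?expR_pow2.
rewrite -expRM_natl -expRD ler_expR mul1r.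
have wt : c * t%:R `^ (- (gamma + eta)) <= w t.
  by apply: hc; rewrite (le_trans _ t2) // ler1n.
have hw : c / 8 * t%:R `^ (beta - 2 * eta) <= b%:R * (w t * K / (4 * t%:R)).
  apply: (@le_trans _ _ (t%:R / 2 * (c * t%:R `^ (- (gamma + eta)) * K / (4 * t%:R)))).
    rewrite [leRHS](_ : _ = c / 8 * (t%:R `^ (- (gamma + eta)) * K)); last first.
      by field; exact: lt0r_neq0.
    rewrite /K powRDE // le_eqVlt; apply/orP; left; apply/eqP; congr (_ * _ `^ _).
    by rewrite /beta; ring.
  apply: ler_pM => //.
    by rewrite !mulr_ge0 ?invr_ge0 ?powR_ge0 ?(ltW K0) ?mulr_ge0 // ltW.
  apply: ler_wpM2r; first by rewrite invr_ge0 mulr_ge0.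
  by apply: ler_wpM2r; rewrite ?(ltW K0).
(* Makes the exponent at least [3 x]; since [L <= x + 1 <= 2 x], the factor [2^L <= e^L] is absorbed
   and [exp(- x)] is left. *)
have hx : 24 / c * x <= t%:R `^ (beta - 2 * eta).
  by rewrite /x; near: t; apply: near_powR; rewrite /eta; lra.
have hx3 : 3 * x <= c / 8 * t%:R `^ (beta - 2 * eta).
  apply: le_trans (ler_wpM2l (divr_ge0 (ltW c0) (ler0n _ 8)) hx).
  by rewrite le_eqVlt; apply/orP; left; apply/eqP; field; exact: lt0r_neq0.
have L3 : L%:R <= x + 1 by rewrite /L -natr1 lerD2r.
rewrite mulrN; move: hw hx3 L3 x1; clear - frv f0 fmono f01 gamma01 w beta; lra.
Unshelve. all: by end_near.
Qed.

Lemma hascl_mono L L' es : (L <= L')%N -> hascl L' es -> hascl L es.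
Proof.
move=> h /asboolP[A [uA sA hA]]; apply/asboolP; exists A; split => //.
exact: leq_trans sA.
Qed.

Lemma sum_prob_ge (h c x : R) S : 0 <= h -> 0 < c -> 2 <= x ->
  (forall y, 1 <= y -> c * y `^ (- h) <= f y) -> S = Num.truncn x ->
  c / 2 * x `^ (1 - h) <= \sum_(1 <= s < S.+1) w s.
Proof.
move=> h0 c0 x2 hc ->; set S' := Num.truncn x.
have x0 : 0 < x by exact: lt_le_trans x2.
have /andP[Sx xS] : S'%:R <= x < S'.+1%:R by exact/truncn_itv/ltW.
have S1 : (0 < S')%N by rewrite /S' truncn_gt_nat (le_trans _ x2) // ler1n.
have hS : x / 2 <= S'%:R by rewrite -natr1 in xS; lra.
have hw : c * x `^ (- h) <= w S'.
  apply: (@le_trans _ _ (c * S'%:R `^ (- h))); last by apply: hc; rewrite ler1n.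
  rewrite ler_pM2l // !powRN lef_pV2 ?posrE ?powR_gt0 ?ltr0n //.
  by apply: ge0_ler_powR; rewrite ?nnegrE // ltW.
apply: (@le_trans _ _ (\sum_(1 <= s < S'.+1) w S')); last first.
  rewrite big_nat_cond [leRHS]big_nat_cond; apply: ler_sum => s.
  by rewrite andbT ltnS => hs; apply: vertex_prob_mono.
rewrite sumr_const_nat subn1 /= -[leRHS]mulr_natl.
apply: (@le_trans _ _ (x / 2 * (c * x `^ (- h)))).
  rewrite -(powRDE 1 (- h) x0) powRr1 ?(ltW x0) // le_eqVlt; apply/orP; left; apply/eqP; by field.
by apply: ler_pM; rewrite ?mulr_ge0 ?powR_ge0 ?invr_ge0 // ltW.
Qed.

Lemma clique_lower (eps N : R) : 0 < eps <= 1 -> eps < beta / 2 -> 0 < N ->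
  \forall t \near \oo,
    Ex w t (fun e => (~~ hascl (Num.truncn (t%:R `^ (beta / 2 - eps))).+2 e)%:R) es0 <=
    1 / (N * ln t%:R).
Proof.
move=> /andP[e0 e1] eb N0.
pose eta := eps / 4; pose k := eta / 4.
have eta0 : 0 < eta by rewrite /eta; lra.
have eta1 : eta <= 1 / 4 by rewrite /eta; lra.
have k01 : 0 < k <= 2^-1 by apply/andP; rewrite /k; split; lra.
have [k0 k1] := andP k01.
have [m0 hm0] := vertex_prob_small k0.
have /andP[ga0 ga1] := gamma01.
have beta0 : 0 < beta by rewrite /beta; lra.
have h0 : 0 <= gamma + eta by lra.
have hg : gamma < gamma + eta by lra.
have [c c0 hc] := rv_lower f01 fmono frv h0 hg.
pose al := 1 - 2 * k.
have al0 : 0 <= al by rewrite /al; lra.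
pose C : R := 16 / k * 4 `^ al.
have hC := @near_inv_ln R (eta / 4) C (3 * N).
have h1 := @near_inv_ln R 1 1 (3 * N) ltr01.
have exW : beta / 2 - eps < (2^-1 - eta) * (1 - (gamma + eta)).
  have -> : 1 - (gamma + eta) = beta - eta by rewrite /beta; ring.
  have b1 : beta <= 1 by rewrite /beta; lra.
  by have : eps = 4 * eta; [rewrite /eta; field|move=> ->; nra].
(* Exponent of the term for low degrees: [K] times the power [al] of birth time over [t], the latter
   being of order [t^(- (1/2 + eta))]. *)
have exe : (2^-1 + eta / 4) + - (2^-1 + eta) * al <= - (eta / 4).
  by rewrite /al /k; nra.
have ex1 : 1 + -2 <= -1 :> R by lra.
have ex2 : 2^-1 - eta + (2^-1 - eta) <= 1 by lra.
near=> t.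
have t2 : 2 <= t%:R :> R by near: t; exact: near_natr_ge.
have t0 : 0 < t%:R :> R by exact: lt_le_trans t2.
have t0' := ltW t0.
have t1 : 1 <= t%:R :> R by rewrite (le_trans _ t2) // ler1n.
set a := t./2; set b := (t - t./2)%N.
have tab : t = (a + b)%N.
  by rewrite /b subnKC // -[leqRHS]odd_double_half -/a -addnn addnA leq_addl.
have [ha hb] := half_bounds t; rewrite -/a -/b in ha hb.
set y := t%:R `^ (beta / 2 - eps).
have y1 : 1 <= y by rewrite /y; near: t; apply: near_powR_ge; lra.
pose x := t%:R `^ (2^-1 - eta); have x0 : 0 < x by apply: powR_gt0.
have x2 : 2 <= x by rewrite /x; near: t; apply: near_powR_ge; lra.
have xm0 : m0.+1%:R <= x by rewrite /x; near: t; apply: near_powR_ge; lra.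
have xt : 4 * x <= t%:R.
  rewrite -[leRHS]powRr1 // /x; near: t; apply: near_powR; lra.
pose S := Num.truncn x.
have /andP[Sx _] : S%:R <= x < S.+1%:R by exact/truncn_itv/ltW.
have Sa : (S <= a)%N.
  have : S%:R < a.+1%:R :> R.
    apply: le_lt_trans Sx _; move: xt ha x0.
    by clear - frv f0 fmono f01 gamma01 w beta; lra.
  by rewrite ltr_nat ltnS.
pose W := \sum_(1 <= s < S.+1) w s.
have W1 : 64 * y <= W.
  apply: le_trans (sum_prob_ge h0 c0 x2 hc (erefl _)).
  rewrite -[leLHS](_ : c / 2 * (2 / c * 64 * y) = _); last by field; exact: lt0r_neq0.
  apply: ler_wpM2l; first by rewrite divr_ge0 // ltW.
  by rewrite /x -powRrM /y; near: t; apply: near_powR.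
have W0 : 0 < W by move: W1 y1; clear - frv f0 fmono f01 gamma01 w beta; lra.
(* [2 L <= W / 4] stays below the [W / 2] in the exponential bound for births, while [L >= W / 16]
   cancels the [W] in the bound for low degrees. *)
pose L := Num.truncn (W / 8).
have /andP[LW WL] : L%:R <= W / 8 < L.+1%:R by apply: truncn_itv; rewrite divr_ge0 // ltW.
have WL' : W / 8 < L%:R + 1 by rewrite natr1.
have L16 : W / 16 <= L%:R by move: WL' W1 y1; clear - frv f0 fmono f01 gamma01 w beta; lra.
have L0' : 0 < L%:R :> R by move: L16 W0; clear - frv f0 fmono f01 gamma01 w beta; lra.
have L0 : (0 < L)%N by rewrite -(ltr_nat R).
have hL : ((Num.truncn y).+2 <= L)%N.
  have /andP[yL _] : (Num.truncn y)%:R <= y < (Num.truncn y).+1%:R.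
    exact/truncn_itv/(le_trans ler01).
  rewrite -(ler_nat R) -natr1 -natr1; move: yL W1 L16 y1.
  by clear - frv f0 fmono f01 gamma01 w beta; lra.
(* [K^2 / t] is a positive power of [t], so a non-adjacent pair survives about [t / 2] steps with
   probability at most [exp(- t^(eta / 2) / 8)], which beats the [S^2 <= t] pairs. *)
pose K : R := t%:R `^ (2^-1 + eta / 4); have K0 : 0 < K by apply: powR_gt0.
have am0 : (m0 <= a.+1)%N.
  have : m0%:R < a.+1%:R :> R.
    by rewrite -natr1 in xm0; move: xm0 xt ha x0; clear - frv f0 fmono f01 gamma01 w beta; lra.
  by rewrite ltr_nat => /ltnW.
have wa : w a.+1 <= 2^-1 by apply: (le_trans _ k1); have [] := hm0 _ am0.
apply: (@le_trans _ _ (Ex w (a + b) (fun e => (~~ hascl L e)%:R) es0)).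
  rewrite -tab; apply: (Ex_mono vertex_prob01) => // e _ _; rewrite ler_nat.
  by case: (boolP (hascl L e)) => [/(hascl_mono hL) ->|_]; rewrite // leq_b1.
apply: le_trans (clique_bound vertex_prob01 vertex_prob_mono k01 hm0 b K0 Sa L0 wa) _.
rewrite -tab -/W -/al.
rewrite (_ : 1 / (N * ln t%:R) = 1 / (3 * N * ln t%:R) + 1 / (3 * N * ln t%:R) +
    1 / (3 * N * ln t%:R)); last first.
  have l0 : ln t%:R != 0 :> R by rewrite gt_eqF // ln_gt0 // (lt_le_trans _ t2) // ltr1n.
  by field; rewrite l0 gt_eqF.
have small : 1 * t%:R `^ (-1) <= 1 / (3 * N * ln t%:R) by near: t; apply: h1; lra.
apply: lerD; first apply: lerD.
- apply: le_trans small; rewrite mul1r.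
  apply: (@le_trans _ _ (expR (- (1 * y)))); last first.
    by rewrite /y; near: t; apply: near_expR_powR; lra.
  apply: le_trans (ler_wpM2r (expR_ge0 _) (expR_pow2 _)) _.
  rewrite -expRD ler_expR natrM mulNr mul1r; move: LW W1 y1.
  by clear - frv f0 fmono f01 gamma01 w beta; lra.
- apply: (@le_trans _ _ (C * t%:R `^ (- (eta / 4)))); last by near: t; apply: hC; lra.
  apply: (@le_trans _ _ (16 / W * (K / k * (4 * t%:R `^ (- (2^-1 + eta))) `^ al * W))).
    apply: ler_pM.
    + by rewrite invr_ge0 ltW.
    + by rewrite !mulr_ge0 ?powR_ge0 ?invr_ge0 ?(ltW K0) ?(ltW k0) ?(ltW W0).
    + by rewrite -[16 / W]invrK lef_pV2 ?posrE ?invr_gt0 ?divr_gt0 // invf_div.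
    apply: ler_wpM2r; first exact: ltW.
    apply: ler_wpM2l; first by rewrite divr_ge0 // ltW.
    apply: ge0_ler_powR; rewrite ?nnegrE ?mulr_ge0 ?invr_ge0 ?powR_ge0 //.
    rewrite ler_pdivrMr ?ltr0n //.
    apply: (@le_trans _ _ (2 * x)).
      rewrite -[(m0 + S).+1%:R]natr1 natrD; rewrite -natr1 in xm0.
      move: Sx xm0; clear - frv f0 fmono f01 gamma01 w beta; lra.
    apply: (@le_trans _ _ (4 * t%:R `^ (- (2^-1 + eta)) * (t%:R / 2))); last first.
      by apply: ler_wpM2l; rewrite ?mulr_ge0 ?powR_ge0.
    rewrite [leRHS](_ : _ = 2 * (t%:R `^ (- (2^-1 + eta)) * t%:R `^ 1)).
      rewrite powRDE // /x le_eqVlt; apply/orP; left; apply/eqP.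
      by congr (_ * _ `^ _); field.
    by rewrite powRr1 //; field.
  rewrite [leLHS](_ : _ = 16 / k * (K * (4 * t%:R `^ (- (2^-1 + eta))) `^ al)); last first.
    by field; rewrite !lt0r_neq0.
  rewrite powRM ?powR_ge0 // -powRrM /C.
  rewrite [leLHS](_ : _ = 16 / k * 4 `^ al * (K * t%:R `^ (- (2^-1 + eta) * al))); last by ring.
  apply: ler_wpM2l; first by rewrite !mulr_ge0 ?powR_ge0 ?invr_ge0 // ltW.
  by rewrite /K powRDE //; apply: ler_powR.
- apply: le_trans small; rewrite mul1r.
  apply: (@le_trans _ _ (t%:R `^ 1 * t%:R `^ (-2))); last first.
    by rewrite powRDE //; apply: ler_powR.
  apply: ler_pM; rewrite ?exprn_ge0 ?expR_ge0 //.
    apply: (@le_trans _ _ (x ^+ 2)); first by apply: lerXn2r; rewrite ?nnegrE // ltW.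
    by rewrite expr2 /x powRDE //; apply: ler_powR.
  apply: (@le_trans _ _ (expR (- (8^-1 * t%:R `^ (eta / 2))))); last first.
    by near: t; apply: near_expR_powR; lra.
  rewrite -expRM_natl ler_expR mulrN lerN2.
  apply: (@le_trans _ _ (t%:R / 2 * (K / (2 * t%:R)) ^+ 2)); last first.
    by apply: ler_wpM2r; rewrite // sqr_ge0.
  have KK : K * K = t%:R * t%:R `^ (eta / 2).
    rewrite -[X in _ = X * _](powRr1 t0').
    by rewrite /K !powRDE //; congr (_ `^ _); field.
  rewrite [leRHS](_ : _ = K * K / (8 * t%:R)); last by field; exact: lt0r_neq0.
  rewrite KK le_eqVlt; apply/orP; left; apply/eqP; field; exact: lt0r_neq0.
Unshelve. all: by end_near.
Qed.

End WithHighProbability.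

(** * From the three estimates to the clustering coefficient *)

Section Clustering.
Variable R : realType.

Lemma bin2_ge n : (2 <= n)%N -> (n ^ 2 <= 4 * 'C(n, 2))%N.
Proof.
case: n => [|[|n]] // _; have := bin_ffact n.+2 2.
rewrite !ffactnS ffactn0 muln1 -mulnn /= => h.
move: ('C(n.+2, 2)) h => B; rewrite (_ : 2`! = 2) //; nia.
Qed.

Lemma bin3_ge n : (3 <= n)%N -> (n ^ 3 <= 27 * 'C(n, 3))%N.
Proof.
case: n => [|[|[|n]]] // _; have := bin_ffact n.+3 3.
rewrite !ffactnS ffactn0 muln1 !expnS expn0 muln1 /= => h.
move: ('C(n.+3, 3)) h => B; rewrite (_ : 3`! = 6) //; nia.
Qed.

Lemma sqr_le_double n m : (2 <= n)%N -> (n * n.-1 <= m)%N -> (n ^ 2 <= 2 * m)%N.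
Proof. by rewrite -mulnn => ? ?; nia. Qed.

Lemma powR_exprn (x a : R) n : (x `^ a) ^+ n = x `^ (a * n%:R).
Proof. by rewrite powRrM powR_mulrn // powR_ge0. Qed.

(** With [b d = 16 e], the exponent [d] on the clique number is worth about [T^(8 e)], more than all
    losses. Below: [ch <= T^(2 (b + e)) <= om^(4 + d)] and [tri >= om^3 / 27], whence
    [3 / 27 = 1/9]. Above: [tri <= T^(3/2 (b + e))], [om <= 2 T^((b + e) / 2)] and
    [ch >= T^(2 (b - e)) / 4], whence [3 * 2 * 4 = 24]. *)
Lemma clustering_bounds g es lab (T b d e : R) :
  @coded g es lab -> 0 < b <= 1 -> 0 < d < 1 -> e = b * d / 16 -> 1 <= T ->
  2 <= T `^ (b - e) -> 1 <= T `^ (b / 2 - e) ->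
  (npairs es)%:R <= T `^ (b + e) -> T `^ (b - e) <= (sdeg0 es)%:R ->
  hascl (Num.truncn (T `^ (b / 2 - e))).+2 es ->
  1 / 9 / (clique_number g)%:R `^ (1 + d) <= global_clustering R g
    <= 24 / (clique_number g)%:R `^ (1 - d).
Proof.
move=> hc /andP[b0 b1] /andP[d0 d1] he T1 hL2 hy1 hA hL hcl.
have T0 : 0 < T by lra.
have bd0 : 0 < b * d by rewrite mulr_gt0.
have e0 : 0 < e by rewrite he; lra.
have de : d * e <= e by rewrite ler_piMl // ltW.
have de0 : 0 < d * e by rewrite mulr_gt0.
have hbd : b * d = 16 * e by rewrite he; field.
set y := T `^ (b / 2 - e) in hy1 hcl.
set M := T `^ (b + e) in hA.
have M0 : 0 < M by apply: powR_gt0.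
have wge : ((Num.truncn y).+2 <= clique_number g)%N by apply: clique_number_ge hc _ hcl.
(* The [.+2] in the clique size thus gives [om >= 3], as [bin3_ge] requires, besides [om >= y]. *)
have ytr : (1 <= Num.truncn y)%N by rewrite truncn_gt_nat.
set om := clique_number g in wge *.
have om3 : (3 <= om)%N by apply: leq_trans wge; rewrite !ltnS.
have omy : y <= om%:R.
  have /andP[_ h] : (Num.truncn y)%:R <= y < (Num.truncn y).+1%:R.
    exact/truncn_itv/(le_trans ler01).
  by apply: (le_trans (ltW h)); rewrite ler_nat ltnW.
have om0 : 0 < om%:R :> R by rewrite ltr0n (leq_trans _ om3).
have AM : (adj_pairs g)%:R <= M by apply: le_trans hA; rewrite ler_nat (adj_pairs_le hc).
have A0 : 0 <= (adj_pairs g)%:R :> R by [].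
set tri : R := (triangles g)%:R; set ch : R := (cherries g)%:R.
have ch_le : ch <= M ^+ 2.
  apply: (@le_trans _ _ ((adj_pairs g)%:R ^+ 2)).
    by rewrite -natrX ler_nat cherries_le.
  by apply: lerXn2r; rewrite ?nnegrE // ltW.
have ch_ge : T `^ (2 * (b - e)) <= 4 * ch.
  have s2 : (2 <= sdeg0 es)%N by rewrite -(ler_nat R) (le_trans hL2).
  apply: (@le_trans _ _ ((sdeg0 es)%:R ^+ 2)).
    rewrite mulrC -(powR_exprn _ _ 2).
    by apply: lerXn2r; rewrite ?nnegrE ?powR_ge0.
  rewrite -natrX -natrM ler_nat; apply: (leq_trans (bin2_ge s2)).
  by rewrite leq_mul2l (cherries_ge_sdeg0 hc).
have ch0 : 0 < ch by have := powR_gt0 (2 * (b - e)) T0; lra.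
have tri_le : tri <= T `^ (3 / 2 * (b + e)).
  rewrite -(@ler_pXn2r _ 2) ?nnegrE ?powR_ge0 //.
  apply: (@le_trans _ _ ((adj_pairs g)%:R ^+ 3)).
    by rewrite -!natrX ler_nat triangles_sqr_le.
  apply: (@le_trans _ _ (M ^+ 3)); first by apply: lerXn2r; rewrite ?nnegrE // ltW.
  rewrite /M (powR_exprn T _ 3) (powR_exprn T _ 2).
  by rewrite le_eqVlt; apply/orP; left; apply/eqP; congr (_ `^ _); field.
have tri_ge : om%:R ^+ 3 <= 27 * tri.
  rewrite -natrX -natrM ler_nat; apply: (leq_trans (bin3_ge om3)).
  by rewrite leq_mul2l triangles_ge.
have om_le : om%:R <= 2 * T `^ ((b + e) / 2).
  rewrite -(@ler_pXn2r _ 2) ?nnegrE ?mulr_ge0 ?powR_ge0 //.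
  rewrite exprMn (powR_exprn T _ 2).
  have -> : (b + e) / 2 * 2 = b + e by field.
  rewrite -/M; apply: (@le_trans _ _ (2 * (adj_pairs g)%:R)); last by rewrite expr2; lra.
  rewrite -natrX -natrM ler_nat.
  exact: sqr_le_double (ltnW om3) (clique_number_le g).
have pw0 (q : R) : 0 < om%:R `^ q by apply: powR_gt0.
apply/andP; split; rewrite /global_clustering -/tri -/ch.
  rewrite ler_pdivrMr // mulrAC ler_pdivlMr //.
  have h1 : ch <= om%:R `^ (4 + d).
    apply: (le_trans ch_le); apply: (@le_trans _ _ (y `^ (4 + d))).
      rewrite /M /y (powR_exprn T _ 2) -powRrM; apply: ler_powR => //.
      by lra.
    by apply: ge0_ler_powR; rewrite ?nnegrE ?(le_trans _ hy1) //; lra.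
  have h2 : om%:R `^ (4 + d) = om%:R ^+ 3 * om%:R `^ (1 + d).
    by rewrite -powR_mulrn // powRDE //; congr (_ `^ _); ring.
  have h3 := ler_wpM2r (ltW (pw0 (1 + d))) tri_ge.
  by move: h1; rewrite h2; lra.
rewrite ler_pdivrMr // mulrAC ler_pdivlMr //.
have h1 : om%:R `^ (1 - d) <= 2 * T `^ ((b + e) / 2 * (1 - d)).
  apply: (@le_trans _ _ ((2 * T `^ ((b + e) / 2)) `^ (1 - d))).
    by apply: ge0_ler_powR; rewrite ?nnegrE ?mulr_ge0 ?powR_ge0 //; lra.
  rewrite powRM ?powR_ge0 // -powRrM; apply: ler_wpM2r; first exact: powR_ge0.
  by apply: ler1_powR; lra.
apply: (@le_trans _ _ (3 * T `^ (3 / 2 * (b + e)) * (2 * T `^ ((b + e) / 2 * (1 - d))))).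
  by apply: ler_pM; rewrite ?mulr_ge0 ?powR_ge0 //; apply: ler_wpM2l.
apply: (@le_trans _ _ (6 * T `^ (2 * (b - e)))); last by lra.
rewrite [leLHS](_ : _ = 6 * (T `^ (3 / 2 * (b + e)) * T `^ ((b + e) / 2 * (1 - d)))); last by ring.
by apply: ler_wpM2l; rewrite // powRDE //; apply: ler_powR => //; lra.
Qed.

End Clustering.

(** * Choice of constants and union bound *)

Local Open Scope classical_set_scope.
Local Open Scope ring_scope.

Theorem corollary1p5 (R : realType) (delta : R) (hdelta : 0 < delta < 1) :
  exists c1 c2 : R, 0 < c1 /\ 0 < c2 /\
    forall (f : R -> R) (gamma : R),
      0 <= gamma < 1 ->
      (forall x, 0 < x -> 0 < f x <= 1) ->
      (forall x y, 0 < x -> x <= y -> f y <= f x) ->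
      f x @[x --> +oo] --> (0 : R) ->
      regularly_varying f (- gamma) ->
      exists t0 : nat,
        forall (d : measure_display) (T : measurableType d)
          (P : probability T R) (Z : nat -> T -> bool) (G : nat -> T -> mgraph),
          edge_step_process P f Z G ->
          forall t : nat, (t0 <= t)%N ->
            ((1 - 1 / ln (t%:R : R))%:E <=
             P [set w |
               (c1 / (clique_number (G t w))%:R `^ (1 + delta)
                  <= global_clustering R (G t w)
                  <= c2 / (clique_number (G t w))%:R `^ (1 - delta))%R])%E.
Proof.
have /andP[d0 d1] := hdelta.
(* Both constants are absolute; [f], [gamma] and [delta] influence only [t0]. *)
exists (1 / 9), 24; split; first lra; split; first lra.
move=> f gamma hgamma f01 fmono f0 frv.
have /andP[g0 g1] := hgamma.
pose beta : R := 1 - gamma; pose eps : R := beta * delta / 16.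
have b01 : 0 < beta <= 1 by apply/andP; rewrite /beta; split; lra.
have /andP[b0 b1] := b01.
have bd : 0 < beta * delta by rewrite mulr_gt0.
have bd1 : beta * delta <= beta by rewrite ler_piMr // ltW.
have e01 : 0 < eps <= 1 by apply/andP; rewrite /eps; split; lra.
have eb : eps < beta by rewrite /eps; lra.
have eb2 : eps < beta / 2 by rewrite /eps; lra.
(* Each of the three bad events receives a third of the failure probability [1 / ln t]. *)
have n3 : 0 < 3 :> R by [].
pose w (m : nat) : R := f m%:R.
pose bad1 t e := (t%:R `^ (beta + eps) < (npairs e)%:R :> R).
pose bad2 t e := ((sdeg0 e)%:R < t%:R `^ (beta - eps) :> R).
pose bad3 t e := ~~ hascl (Num.truncn (t%:R `^ (beta / 2 - eps))).+2 e.
have [t0 _ ht0] : \forall t \near \oo,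
    [/\ 2 <= t%:R :> R, 2 <= t%:R `^ (beta - eps), 1 <= t%:R `^ (beta / 2 - eps) &
     [/\ Ex w t (fun e => (bad1 t e)%:R) es0 <= 1 / (3 * ln t%:R),
         Ex w t (fun e => (bad2 t e)%:R) es0 <= 1 / (3 * ln t%:R) &
         Ex w t (fun e => (bad3 t e)%:R) es0 <= 1 / (3 * ln t%:R)]].
  near=> t; split; last split; near: t.
  - exact: near_natr_ge.
  - by apply: near_powR_ge; lra.
  - by apply: near_powR_ge; lra.
  - exact: edges_upper.
  - exact: leaf_lower.
  - exact: clique_lower.
exists t0 => d T P Z G proc t /ht0 [t2 hL2 hy1 [h1 h2 h3]].
have l0 : 0 < ln t%:R :> R by rewrite ln_gt0 // (lt_le_trans _ t2) // ltr1n.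
pose phi t e := [&& ~~ bad1 t e, ~~ bad2 t e & ~~ bad3 t e].
apply: (@le_trans _ _ (Ex w t (fun e => (phi t e)%:R) es0)%:E).
  have hone := Ex_cst (vertex_prob01 f01) t 1 wf_es0.
  have : 1 <= Ex w t (fun e => (phi t e)%:R) es0 + Ex w t (fun e => (bad1 t e)%:R) es0 +
      Ex w t (fun e => (bad2 t e)%:R) es0 + Ex w t (fun e => (bad3 t e)%:R) es0.
    rewrite -[leLHS]hone -!ExD; apply: (Ex_mono (vertex_prob01 f01)) => // e _ _.
    by rewrite /phi; case: (bad1 t e); case: (bad2 t e); case: (bad3 t e) => /=; lra.
  have : 1 / ln t%:R = 1 / (3 * ln t%:R) + 1 / (3 * ln t%:R) + 1 / (3 * ln t%:R) :> R.
    by field; rewrite gt_eqF.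
  by rewrite lee_fin => -> ?; lra.
apply: (process_lower proc (phi := phi t) (A := [set g |
  (1 / 9 / (clique_number g)%:R `^ (1 + delta) <= global_clustering R g
     <= 24 / (clique_number g)%:R `^ (1 - delta))%R])).
move=> g es lab hc _ /and3P[]; rewrite /bad1 /bad2 /bad3 -!leNgt negbK => k1 k2 k3.
apply: (clustering_bounds hc b01 hdelta (erefl _) _ hL2 hy1 k1 k2 k3).
by rewrite (le_trans _ t2) // ler1n.
Unshelve. all: by end_near.
Qed.
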